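(* For every integer $k\ge 1$, every $(=k)$-string graph is also a $(=4k)$-string graph; that is, the class of $(=k)$-string graphs is a subclass of the class of $(=4k)$-string graphs.
   Context: Graphs are finite, simple and undirected. A string representation of a graph $G=(V,E)$ is a collection $R=\{R(v): v\in V\}$ of curves in the plane such that for any two distinct vertices $u,v\in V$, $R(u)\cap R(v)\neq\emptyset$ if and only if $\{u,v\}\in E$. A string representation $R$ is proper if every curve in $R$ is a simple piecewise linear curve with finitely many bends, any two curves in $R$ intersect in at most finitely many points, no three curves in $R$ intersect in one point, and no intersection point of two curves coincides with a bend or an endpoint of a curve (so every intersection of two curves is a crossing). For $m\ge 1$, a $(=m)$-string representation is a proper string representation in which any two curves are either disjoint or intersect in precisely $m$ points. A graph is a $(=m)$-string graph if it has a $(=m)$-string representation. *)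

(* Defs.v *)
From HB Require Import structures.
From mathcomp Require Import all_boot all_order all_algebra.
From mathcomp Require Import all_classical all_reals all_analysis.

Set Implicit Arguments.
Unset Strict Implicit.
Unset Printing Implicit Defensive.

Import Order.TTheory GRing.Theory Num.Theory.
Import numFieldNormedType.Exports.

Local Open Scope classical_set_scope.
Local Open Scope ring_scope.

Section Curves.
Variable R : realType.

(* A curve in the plane is a map [g : R -> R * R] of which only the values on
   [[0, 1]] matter; [trace g] is its point set. *)
Implicit Types g : R -> R * R.

Definition trace g : set (R * R) := g @` `[0, 1].

Definition is_curve g := {within `[0, 1], continuous g}.

Definition simple_curve g := set_inj `[0, 1] g.

Definition affine_on g (a b : R) :=
  exists p d : R * R, forall t, a <= t <= b -> g t = p + t *: d.

(* The subdivision [0 < s_0 < ... < s_n = 1] is finite, so a piecewise linear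
   curve has only finitely many bends. *)
Definition piecewise_linear g :=
  exists s : seq R, itv_partition 0 1 s /\
    forall i, (i < size s)%N -> affine_on g (nth 0 (0 :: s) i) (nth 0 s i).

(* Near [t] the curve stays on one line.  A subdivision point at which only the
   speed of the parametrization changes is therefore not a bend. *)
Definition straight_at g (t : R) :=
  exists d : R * R, \forall s \near t, exists c : R, g s = g t + c *: d.

Definition bends g : set (R * R) :=
  g @` [set t | 0 < t < 1 /\ ~ straight_at g t].

Definition endpoints g : set (R * R) := [set g 0; g 1].

Section Representations.
Variables (V : finType) (e : rel V).
Implicit Types S : V -> R -> R * R.

Definition string_representation S :=
  (forall v, is_curve (S v)) /\
  (forall u v, u != v -> trace (S u) `&` trace (S v) !=set0 <-> e u v).

Definition proper_representation S :=
  [/\ forall v, simple_curve (S v) /\ piecewise_linear (S v),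
      forall u v, u != v -> finite_set (trace (S u) `&` trace (S v)),
      forall u v w, u != v -> u != w -> v != w ->
        trace (S u) `&` trace (S v) `&` trace (S w) = set0 &
      forall u v w, u != v ->
        trace (S u) `&` trace (S v) `&` (bends (S w) `|` endpoints (S w))
          = set0].

Definition exact_string_representation (m : nat) S :=
  [/\ string_representation S, proper_representation S &
      forall u v, u != v ->
        trace (S u) `&` trace (S v) = set0 \/
        (trace (S u) `&` trace (S v) #= `I_m)%card].

End Representations.

(* A graph is a finite vertex type with a symmetric irreflexive relation; the
   definition does not itself impose these two conditions on [e]. *)
Definition exact_string_graph (m : nat) (V : finType) (e : rel V) :=
  exists S : V -> R -> R * R, exact_string_representation e m S.

End Curves.

Arguments exact_string_graph R m {V} e.

(* Main.v *)
(* Every curve is doubled: it is followed from its start to its end and then back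
   along a nearby copy, so each crossing of two of the curves
   becomes four.  To keep the doubled curve ("hairpin") simple, every vertex
   of the polygonal arc is moved along a vector lying to the left of both edges at
   this vertex, so that for small [eps] the arcs obtained by moving the vertices by
   [s] times these vectors, [0 <= s <= eps], sweep out an embedded strip.  For the
   count, non-bend subdivision points are removed first: then no vertex of an arc
   lies on another arc, so two edges of different arcs are either disjoint or cross
   transversally in their interiors, and both alternatives survive small
   perturbations. *)

Require Import Defs.
From mathcomp Require Import all_boot all_order all_algebra.
From mathcomp Require Import all_classical all_reals all_analysis.
From mathcomp Require Import ring lra zify.

Set Implicit Arguments.
Unset Strict Implicit.
Unset Printing Implicit Defensive.

Import Order.TTheory GRing.Theory Num.Theory.
Import numFieldNormedType.Exports.

Local Open Scope classical_set_scope.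
Local Open Scope ring_scope.

(** * Plane geometry *)

Section Plane.
Variable R : realType.
Implicit Types (a b c d n : R * R) (s t : R) (p : nat -> R * R) (N : nat).

(** The strip has to be embedded for all displacements in [[0, eps]], not only for the two extreme
    ones, because the closing edge of a hairpin is swept by the last vertex as the displacement
    varies. So each hairpin lies in its strip, and simplicity, absence of triple points and
    clearance of vertices become statements about strips. The vectors exist because two consecutive
    edges have a common left side unless the second runs straight back along the first, which
    simplicity forbids. Removing non-bends is forced by the notion of properness: it keeps bends and
    endpoints off the other curves, but a subdivision point where the curve stays straight may be a
    crossing. The factor 4 is not obtained by matching points with points. Both intersections are
    counted by the pairs of edges that meet at displacement 0, with one copy of each arc before the
    doubling and two after it; closing edges add nothing, since they are swept by vertices that stay
    off the other strips. Each requirement on [eps] is an open condition on a compact parameter set,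
    for finitely many tuples of segments, so one [eps] serves all curves. *)

Definition cross a b : R := a.1 * b.2 - a.2 * b.1.

Lemma scale_pairE t a : t *: a = (t * a.1, t * a.2).
Proof. by case: a. Qed.

Lemma add_pairE a b : a + b = (a.1 + b.1, a.2 + b.2).
Proof. by case: a; case: b. Qed.

Lemma opp_pairE a : - a = (- a.1, - a.2).
Proof. by case: a. Qed.

Definition pairE := (scale_pairE, opp_pairE, add_pairE).

Lemma eq_pair a b : a.1 = b.1 -> a.2 = b.2 -> a = b.
Proof. by case: a b => [a1 a2] [b1 b2] /= -> ->. Qed.

Definition between a b t := a + t *: (b - a).

Lemma between0 a b : between a b 0 = a.
Proof. by rewrite /between scale0r addr0. Qed.

Lemma between1 a b : between a b 1 = b.
Proof. by rewrite /between scale1r addrC subrK. Qed.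

Lemma betweenC a b t : between a b t = between b a (1 - t).
Proof. apply: eq_pair; rewrite /between !pairE /=; ring. Qed.

Lemma betweenaa a t : between a a t = a.
Proof. by rewrite /between subrr scaler0 addr0. Qed.

Lemma between_inj a b t t' : a <> b -> between a b t = between a b t' -> t = t'.
Proof.
case: a b => [a1 a2] [b1 b2] ab; rewrite /between !pairE /= => -[e1 e2].
have [e|ne] := eqVneq a1 b1.
  have ne2 : b2 - a2 != 0 by rewrite subr_eq0; apply/eqP => f; apply: ab; congr pair.
  by apply: (mulIf ne2); lra.
have ne1 : b1 - a1 != 0 by rewrite subr_eq0 eq_sym.
by apply: (mulIf ne1); lra.
Qed.

(** For independent directions the system [cross d n = 1], [cross d' n = 1] is solved by Cramer's
    rule. Otherwise [d'] is a multiple of [d], positive by assumption, and the quarter turn of [d]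
    serves both. *)
Lemma common_normal d d' : d <> 0 -> d' <> 0 ->
    (forall r, 0 < r -> d' <> - (r *: d)) ->
  exists n, 0 < cross d n /\ 0 < cross d' n.
Proof.
case: d d' => [x y] [x' y']; rewrite /cross => d0 d'0; rewrite /= => par.
pose D := x * y' - y * x'.
have [D0|D0] := eqVneq D 0; last first.
  exists ((x' - x) / D, (y' - y) / D) => /=; split.
    have -> : x * ((y' - y) / D) - y * ((x' - x) / D) = 1.
      rewrite /D; field; exact: D0.
    exact: ltr01.
  have -> : x' * ((y' - y) / D) - y' * ((x' - x) / D) = 1.
    rewrite /D; field; exact: D0.
  exact: ltr01.
have q0 : 0 < x ^+ 2 + y ^+ 2.
  rewrite lt_neqAle addr_ge0 ?sqr_ge0 // andbT eq_sym paddr_eq0 ?sqr_ge0 //.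
  rewrite !sqrf_eq0; apply/negP => /andP[/eqP X /eqP Y].
  by apply: d0; rewrite X Y.
set q := x ^+ 2 + y ^+ 2 in q0.
have qn : q != 0 by rewrite gt_eqF.
pose m := (x * x' + y * y') / q.
have ex : x' = m * x.
  apply: (mulIf qn); rewrite mulrAC divfK //.
  have : y * D = 0 by rewrite D0 mulr0.
  by rewrite /q /D; lra.
have ey : y' = m * y.
  apply: (mulIf qn); rewrite mulrAC divfK //.
  have : x * D = 0 by rewrite D0 mulr0.
  by rewrite /q /D; lra.
have m0 : 0 < m.
  have [//|mneg|mz] := ltgtP 0 m.
    have := par (- m); rewrite oppr_gt0 => /(_ mneg) []. 
    by rewrite !pairE /= ex ey; congr pair; ring.
  by case: d'0; rewrite ex ey -mz !mul0r.
exists (- y, x) => /=; rewrite ex ey; split; last first.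
  rewrite (_ : _ - _ = m * q); last by rewrite /q; ring.
  exact: mulr_gt0.
by rewrite (_ : _ - _ = q) // /q; ring.
Qed.

(* Parallel segments with a common point overlap, so that one of them contains an
   endpoint of the other. *)
Lemma crossing_transversal a b c d t t' : 0 <= t <= 1 -> 0 <= t' <= 1 ->
    between a b t = between c d t' -> a <> b ->
    (forall r, 0 <= r <= 1 ->
       [/\ between a b r <> c, between a b r <> d,
           between c d r <> a & between c d r <> b]) ->
  [/\ cross (b - a) (d - c) != 0, 0 < t < 1 & 0 < t' < 1].
Proof.
move=> t01 t'01 e ab av; split; last 2 first.
- have [_ _ v3 v4] := av t' t'01.
  case/andP: (t01); rewrite !le_eqVlt => /orP[/eqP h|->].
    by case: v3; rewrite -e -h between0.
  by move=> /orP[/eqP h|->] //; case: v4; rewrite -e h between1.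
- have [v1 v2 _ _] := av t t01.
  case/andP: (t'01); rewrite !le_eqVlt => /orP[/eqP h|->].
    by case: v1; rewrite e -h between0.
  by move=> /orP[/eqP h|->] //; case: v2; rewrite e h between1.
apply/eqP => D0.
have [m em] : exists m, d - c = m *: (b - a).
  pose x := (b - a).1; pose y := (b - a).2.
  have q0 : x ^+ 2 + y ^+ 2 != 0.
    rewrite paddr_eq0 ?sqr_ge0 // !sqrf_eq0.
    apply/negP => /andP[/eqP X /eqP Y].
    by apply: ab; symmetry; apply/subr0_eq/eq_pair.
  exists ((x * (d - c).1 + y * (d - c).2) / (x ^+ 2 + y ^+ 2)).
  move: D0; rewrite /cross -/x -/y => D0.
  apply: eq_pair; rewrite scale_pairE /= -/x -/y; apply: (mulIf q0);
    rewrite mulrAC divfK //.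
    have : y * (x * (d - c).2 - y * (d - c).1) = 0 by rewrite D0 mulr0.
    by rewrite /=; lra.
  have : x * (x * (d - c).2 - y * (d - c).1) = 0 by rewrite D0 mulr0.
  by rewrite /=; lra.
have par r : between c d r = between a b (t + (r - t') * m).
  have : between c d r = between c d t' + (r - t') *: (d - c).
    by apply: eq_pair; rewrite /between !pairE /=; ring.
  rewrite -e em => ->.
  by apply: eq_pair; rewrite /between !pairE /=; ring.
have ec := par 0; have ed := par 1; rewrite between0 between1 in ec ed.
set g := t + _ in ec; set h := t + _ in ed.
have ng : ~~ (0 <= g <= 1) by apply/negP => /av[v _ _ _]; apply: v.
have nh : ~~ (0 <= h <= 1) by apply/negP => /av[_ v _ _]; apply: v.
have m0 : m != 0.
  apply/eqP => m0; move: ng; rewrite /g m0 mulr0 addr0 => /negP; exact.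
(* [g] and [h] lie outside the unit interval on opposite sides of [t], so the segment from [c] to
   [d] covers the one from [a] to [b]. The number here is the parameter of [a] on it. *)
have st : 0 <= t' + (0 - t) / m <= 1.
  have [t0 t1] := andP t01; have [t'0 t'1] := andP t'01.
  have eg : g = t - t' * m by rewrite /g; ring.
  have eh : h = t + (1 - t') * m by rewrite /h; ring.
  have [mp|mn] := ltP 0 m.
    rewrite -(ler_pM2r mp) -[X in _ && X](ler_pM2r mp) mulrDl divfK // mul0r mul1r.
    have p1 : 0 <= t' * m by rewrite mulr_ge0 // ltW.
    have p2 : 0 <= (1 - t') * m by rewrite mulr_ge0 ?subr_ge0 // ltW.
    apply/andP; split; lra.
  have mn' : m < 0 by rewrite lt_neqAle m0.
  rewrite -(ler_nM2r mn') -[X in _ && X](ler_nM2r mn') mulrDl divfK // mul0r mul1r.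
  have p1 : t' * m <= 0 by rewrite mulr_ge0_le0.
  have p2 : (1 - t') * m <= 0 by rewrite mulr_ge0_le0 // subr_ge0.
  apply/andP; split; lra.
have [_ _ v _] := av _ st; apply: v; rewrite par.
rewrite [t' + _]addrC addrK divfK // sub0r subrr.
exact: between0.
Qed.

End Plane.

(** * Small perturbations of segments *)

Section Stability.
Variable R : realType.
Implicit Types (a b c d m n : R * R) (s t e : R).

Let params : Type := ((R * R * R) * (R * R * R))%type.
Let ctn (f : params -> R) : Prop := continuous f.

Let ctnD f g : ctn f -> ctn g -> ctn (fun z => f z + g z).
Proof. by move=> cf cg z; apply: cvgD; [exact: cf|exact: cg]. Qed.

Let ctnN f : ctn f -> ctn (fun z => - f z).
Proof. by move=> cf z; apply: cvgN; exact: cf. Qed.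

Let ctnM f g : ctn f -> ctn g -> ctn (fun z => f z * g z).
Proof. by move=> cf cg z; apply: cvgM; [exact: cf|exact: cg]. Qed.

Let ctn_cst r : ctn (fun _ => r).
Proof. by move=> z; exact: cvg_cst. Qed.

Local Lemma ctn_proj : [/\ ctn (fun z => z.1.1.1), ctn (fun z => z.1.1.2), ctn (fun z => z.1.2) &
  [/\ ctn (fun z => z.2.1.1), ctn (fun z => z.2.1.2) & ctn (fun z => z.2.2)]].
Proof.
have F (U V : topologicalType) (f : params -> U * V) :
    continuous (f : params -> _) -> continuous (fun z : params => (f z).1).
  by move=> cf z; apply: cvg_comp (cf z) _; exact: cvg_fst.
have S (U V : topologicalType) (f : params -> U * V) :
    continuous (f : params -> _) -> continuous (fun z : params => (f z).2).
  by move=> cf z; apply: cvg_comp (cf z) _; exact: cvg_snd.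
have I : continuous (fun z : params => z) by move=> z; exact: cvg_id.
have P1 := F _ _ _ I; have P2 := S _ _ _ I.
split; [|exact: S (F _ _ _ P1)|exact: S P1|split].
- exact: F (F _ _ _ P1).
- exact: F (F _ _ _ P2).
- exact: S (F _ _ _ P2).
- exact: S P2.
Qed.

Local Ltac cont :=
  rewrite /cross /=;
  match goal with |- continuous ?f => change (ctn f) end;
  case: ctn_proj => C1 C2 C3 [C4 C5 C6];
  repeat match goal with
  | |- ctn (fun z => _ + _) => apply: ctnD
  | |- ctn (fun z => - _) => apply: ctnN
  | |- ctn (fun z => _ * _) => apply: ctnM
  | |- ctn (fun z => _) => first [assumption | apply: ctn_cst]
  end.

(** The common source of all stability statements: a triple of edge parameters ranges over a compact
    cube, so positivity at displacement 0 persists uniformly over the cube for small displacements.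
    Three of each kind are enough to treat triple points. *)
Lemma stable_positive (g : (R * R * R) * (R * R * R) -> R) :
    continuous g ->
    (forall t1 t2 t3, 0 <= t1 <= 1 -> 0 <= t2 <= 1 -> 0 <= t3 <= 1 ->
       0 < g (t1, t2, t3, (0, 0, 0))) ->
  \forall e \near 0^'+, forall s1 s2 s3 t1 t2 t3,
    0 <= s1 <= e -> 0 <= s2 <= e -> 0 <= s3 <= e ->
    0 <= t1 <= 1 -> 0 <= t2 <= 1 -> 0 <= t3 <= 1 ->
    0 < g (t1, t2, t3, (s1, s2, s3)).
Proof.
move=> cg g0.
have /compact_near_coveringP K : compact (`[0, 1] `*` `[0, 1] `*` `[0, 1] : set (R * R * R)).
  by do 2?apply: compact_setX; exact: segment_compact.
have : \forall s \near ((0, 0, 0) : R * R * R),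
    `[0, 1] `*` `[0, 1] `*` `[0, 1] `<=` [set t : R * R * R | 0 < g (t, s)].
  apply: (K _ (nbhs ((0, 0, 0) : R * R * R)) (fun y x => 0 < g (x, y))) => -[[t1 t2] t3] [[]] /=; rewrite !in_itv /= => h1 h2 h3.
  have := cg (t1, t2, t3, (0, 0, 0)).
  move/cvgr_gt => /(_ 0 (g0 _ _ _ h1 h2 h3)).
  by case=> -[A B] /= [nA nB] AB; exists (A, B) => //= -[x y] /= [xA yB]; apply: AB.
move=> /nbhs_ballP[r /= r0 rb].
near=> e => s1 s2 s3 t1 t2 t3 h1 h2 h3 k1 k2 k3.
have er : e < r by near: e; exact: nbhs_right_lt.
have bl s : 0 <= s <= e -> ball (0 : R) r s.
  by move=> /andP[? ?]; rewrite -ball_normE /ball_ /= sub0r normrN ger0_norm //; lra.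
have B : ball ((0, 0, 0) : R * R * R) r (s1, s2, s3).
  by split; [split|]; exact: bl.
by apply: (rb _ B (t1, t2, t3)); split; [split|]; rewrite /= in_itv.
Unshelve. all: by end_near. Qed.

(** Three points coincide exactly when the sum of two squared distances vanishes, which turns the
    absence of a common point into positivity of a polynomial. *)
Lemma stable_disjoint3 a1 b1 m1 n1 a2 b2 m2 n2 a3 b3 m3 n3 :
    (forall t1 t2 t3, 0 <= t1 <= 1 -> 0 <= t2 <= 1 -> 0 <= t3 <= 1 ->
       between a1 b1 t1 = between a2 b2 t2 -> between a1 b1 t1 <> between a3 b3 t3) ->
  \forall e \near 0^'+, forall s1 s2 s3 t1 t2 t3,
    0 <= s1 <= e -> 0 <= s2 <= e -> 0 <= s3 <= e ->
    0 <= t1 <= 1 -> 0 <= t2 <= 1 -> 0 <= t3 <= 1 ->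
    between (a1 + s1 *: m1) (b1 + s1 *: n1) t1 =
      between (a2 + s2 *: m2) (b2 + s2 *: n2) t2 ->
    between (a1 + s1 *: m1) (b1 + s1 *: n1) t1 <>
      between (a3 + s3 *: m3) (b3 + s3 *: n3) t3.
Proof.
move=> dis.
pose sg a b m n s t := between (a + s *: m) (b + s *: n) t.
pose dd a b := (a.1 - b.1) * (a.1 - b.1) + (a.2 - b.2) * (a.2 - b.2) : R.
have dd0 a b : (dd a b == 0) = (a == b).
  apply/eqP/eqP => [|->]; last by rewrite /dd !subrr !mulr0 addr0.
  move=> /eqP; rewrite paddr_eq0 -?expr2 ?sqr_ge0 // !sqrf_eq0 !subr_eq0.
  by move=> /andP[/eqP ? /eqP ?]; exact: eq_pair.
have ddp a b : 0 <= dd a b by rewrite addr_ge0 // -expr2 sqr_ge0.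
pose g (z : (R * R * R) * (R * R * R)) :=
  dd (sg a1 b1 m1 n1 z.2.1.1 z.1.1.1) (sg a2 b2 m2 n2 z.2.1.2 z.1.1.2) +
  dd (sg a1 b1 m1 n1 z.2.1.1 z.1.1.1) (sg a3 b3 m3 n3 z.2.2 z.1.2).
have /stable_positive : continuous g.
  (* In coordinates [g] is visibly built from sums and products, the form that [cont] decomposes. *)
  rewrite (_ : g = fun z =>
    let A a b m n s t := (a.1 + s * m.1 + t * (b.1 + s * n.1 - (a.1 + s * m.1)),
                          a.2 + s * m.2 + t * (b.2 + s * n.2 - (a.2 + s * m.2))) in
    dd (A a1 b1 m1 n1 z.2.1.1 z.1.1.1) (A a2 b2 m2 n2 z.2.1.2 z.1.1.2) +
    dd (A a1 b1 m1 n1 z.2.1.1 z.1.1.1) (A a3 b3 m3 n3 z.2.2 z.1.2)).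
    by rewrite /dd; cont.
  by apply/funext => z; rewrite /g /sg /between !pairE /=.
have pos x y z : (x = y -> x <> z) -> 0 < dd x y + dd x z.
  move=> xyz; rewrite lt_neqAle addr_ge0 // andbT eq_sym paddr_eq0 // !dd0.
  by apply/negP => /andP[/eqP h /eqP]; exact: xyz.
have h t1 t2 t3 : 0 <= t1 <= 1 -> 0 <= t2 <= 1 -> 0 <= t3 <= 1 ->
    0 < g (t1, t2, t3, (0, 0, 0)).
  by move=> *; apply: pos; rewrite /sg !scale0r !addr0; exact: dis.
move=> /(_ h); apply: filterS => e ge s1 s2 s3 t1 t2 t3 *.
move=> h3; have : 0 < g (t1, t2, t3, (s1, s2, s3)) by exact: ge.
rewrite lt_neqAle => /andP[+ _]; rewrite eq_sym /g /= paddr_eq0 // !dd0.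
by move=> /negP; apply; apply/andP; split; apply/eqP.
Qed.

Lemma stable_disjoint a1 b1 m1 n1 a2 b2 m2 n2 :
    (forall t1 t2, 0 <= t1 <= 1 -> 0 <= t2 <= 1 ->
       between a1 b1 t1 <> between a2 b2 t2) ->
  \forall e \near 0^'+, forall s1 s2 t1 t2,
    0 <= s1 <= e -> 0 <= s2 <= e -> 0 <= t1 <= 1 -> 0 <= t2 <= 1 ->
    between (a1 + s1 *: m1) (b1 + s1 *: n1) t1 <>
      between (a2 + s2 *: m2) (b2 + s2 *: n2) t2.
Proof.
move=> dis; have := @stable_disjoint3 a1 b1 m1 n1 a2 b2 m2 n2 a2 b2 m2 n2.
move=> /(_ (fun t1 t2 _ h1 h2 _ h => False_ind _ (dis _ _ h1 h2 h))).
apply: filterS => e h s1 s2 t1 t2 hs1 hs2 ht1 ht2 eq.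
exact: (h s1 s2 s2 t1 t2 t2).
Qed.

Lemma stable_cross_gt0 a b m n : 0 < cross a b ->
  \forall e \near 0^'+, forall s1 s2, 0 <= s1 <= e -> 0 <= s2 <= e ->
    0 < cross (a + s1 *: m) (b + s2 *: n).
Proof.
move=> ab.
pose g (z : (R * R * R) * (R * R * R)) :=
  (a.1 + z.2.1.1 * m.1) * (b.2 + z.2.1.2 * n.2) -
  (a.2 + z.2.1.1 * m.2) * (b.1 + z.2.1.2 * n.1).
have /stable_positive : continuous g by rewrite /g; cont.
have h t1 t2 t3 : 0 <= t1 <= 1 -> 0 <= t2 <= 1 -> 0 <= t3 <= 1 ->
    0 < g (t1, t2, t3, (0, 0, 0)).
  by move=> _ _ _; rewrite /g /= !mul0r !addr0.
move=> /(_ h); apply: filterS => e ge s1 s2 h1 h2.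
have := ge s1 s2 s2 0 0 0 h1 h2 h2; rewrite lexx ler01 => /(_ erefl erefl erefl).
by rewrite /g /cross !pairE.
Qed.

(** Cramer's rule for two non-parallel lines, free of division so that all terms are polynomial in
    the endpoints. *)
Lemma between_eqP a b c d t t' : cross (b - a) (d - c) != 0 ->
  between a b t = between c d t' <->
  t * cross (b - a) (d - c) = cross (c - a) (d - c) /\
  t' * cross (b - a) (d - c) = cross (c - a) (b - a).
Proof.
case: a b c d => [a1 a2] [b1 b2] [c1 c2] [d1 d2].
rewrite /cross /between !pairE /= => D0; split.
  move=> [e1 e2].
  have X r r' : r * (a1 + t * (b1 - a1)) = r * (c1 + t' * (d1 - c1)) /\
      r' * (a2 + t * (b2 - a2)) = r' * (c2 + t' * (d2 - c2)) by rewrite e1 e2.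
  by split; [case: (X (d2 - c2) (d1 - c1))|case: (X (b2 - a2) (b1 - a1))]; lra.
move=> [e1 e2]; congr pair; apply: (mulIf D0).
  have : (b1 - a1) * (t * ((b1 - a1) * (d2 - c2) - (b2 - a2) * (d1 - c1))) =
    (b1 - a1) * ((c1 - a1) * (d2 - c2) - (c2 - a2) * (d1 - c1)) by rewrite e1.
  have : (d1 - c1) * (t' * ((b1 - a1) * (d2 - c2) - (b2 - a2) * (d1 - c1))) =
    (d1 - c1) * ((c1 - a1) * (b2 - a2) - (c2 - a2) * (b1 - a1)) by rewrite e2.
  lra.
have : (b2 - a2) * (t * ((b1 - a1) * (d2 - c2) - (b2 - a2) * (d1 - c1))) =
  (b2 - a2) * ((c1 - a1) * (d2 - c2) - (c2 - a2) * (d1 - c1)) by rewrite e1.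
have : (d2 - c2) * (t' * ((b1 - a1) * (d2 - c2) - (b2 - a2) * (d1 - c1))) =
  (d2 - c2) * ((c1 - a1) * (b2 - a2) - (c2 - a2) * (b1 - a1)) by rewrite e2.
lra.
Qed.

(** Uniqueness is over all real parameters, that is, on the full lines; a transversal crossing
    provides this, and no bounds need checking when it is used. *)
Definition cross_once a b c d := exists t t', [/\ 0 < t < 1, 0 < t' < 1,
  between a b t = between c d t' &
  forall r r', between a b r = between c d r' -> r = t /\ r' = t'].

(** The crossing parameters are [T / D] and [T' / D]. Multiplying the bounds 0 and 1 by [D ^+ 2]
    gives strict polynomial inequalities that do not depend on the sign of [D], as [stable_positive]
    requires. *)
Lemma cross_onceP a b c d (D := cross (b - a) (d - c))
    (T := cross (c - a) (d - c)) (T' := cross (c - a) (b - a)) :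
  [/\ 0 < D * T, 0 < D * T', 0 < D * (D - T) & 0 < D * (D - T')] ->
  cross_once a b c d.
Proof.
case=> h1 h2 h3 h4.
have D0 : D != 0 by apply: contraTneq h1 => ->; rewrite mul0r ltxx.
have DD : 0 < D ^+ 2 by rewrite lt_neqAle sqr_ge0 andbT eq_sym sqrf_eq0.
have itv X : 0 < D * X -> 0 < D * (D - X) -> 0 < X / D < 1.
  move=> x1 x2; rewrite (_ : X / D = (D * X) / D ^+ 2); last by field.
  by rewrite divr_gt0 // ltr_pdivrMr // mul1r -subr_gt0 expr2 -mulrBr x2.
exists (T / D), (T' / D); split; [exact: itv|exact: itv| |].
  by apply/between_eqP; rewrite ?divfK.
by move=> r r' /(between_eqP _ _ D0) [e1 e2]; rewrite /T /T' -e1 -e2 !mulfK.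
Qed.

(** At displacement 0 the quantities of [cross_onceP] are [D ^+ 2] times [t], [t'], [1 - t] and
    [1 - t'], hence positive for an interior crossing. *)
Lemma stable_cross_once a b c d ma mb mc md t t' :
    cross (b - a) (d - c) != 0 -> 0 < t < 1 -> 0 < t' < 1 ->
    between a b t = between c d t' ->
  \forall e \near 0^'+, forall s1 s2, 0 <= s1 <= e -> 0 <= s2 <= e ->
    cross_once (a + s1 *: ma) (b + s1 *: mb) (c + s2 *: mc) (d + s2 *: md).
Proof.
move=> D0 /andP[t0 t1] /andP[t'0 t'1] /(between_eqP _ _ D0)[e1 e2].
have DD : 0 < cross (b - a) (d - c) ^+ 2.
  by rewrite lt_neqAle sqr_ge0 andbT eq_sym sqrf_eq0.
pose dif a b m n s := (b.1 + s * n.1 - (a.1 + s * m.1),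
                       b.2 + s * n.2 - (a.2 + s * m.2)) : R * R.
pose mov c mc s a ma s' := (c.1 + s * mc.1 - (a.1 + s' * ma.1),
                       c.2 + s * mc.2 - (a.2 + s' * ma.2)) : R * R.
pose D (z : (R * R * R) * (R * R * R)) :=
   cross (dif a b ma mb z.2.1.1) (dif c d mc md z.2.1.2).
pose T (z : (R * R * R) * (R * R * R)) :=
   cross (mov c mc z.2.1.2 a ma z.2.1.1) (dif c d mc md z.2.1.2).
pose T' (z : (R * R * R) * (R * R * R)) :=
   cross (mov c mc z.2.1.2 a ma z.2.1.1) (dif a b ma mb z.2.1.1).
have DE t1' t2' t3' : D (t1', t2', t3', (0, 0, 0)) = cross (b - a) (d - c).
  by rewrite /D /dif /cross !pairE /= !mul0r !addr0.
have TE t1' t2' t3' : T (t1', t2', t3', (0, 0, 0)) = t * cross (b - a) (d - c).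
  by rewrite e1 /T /mov /dif /cross !pairE /= !mul0r !addr0.
have T'params t1' t2' t3' : T' (t1', t2', t3', (0, 0, 0)) = t' * cross (b - a) (d - c).
  by rewrite e2 /T' /mov /dif /cross !pairE /= !mul0r !addr0.
have cD : continuous D by rewrite /D /dif; cont.
have cT : continuous T by rewrite /T /mov /dif; cont.
have cT' : continuous T' by rewrite /T' /mov /dif; cont.
have c1 : continuous (fun z => D z * T z) := ctnM cD cT.
have c2 : continuous (fun z => D z * T' z) := ctnM cD cT'.
have c3 : continuous (fun z => D z * (D z - T z)) := ctnM cD (ctnD cD (ctnN cT)).
have c4 : continuous (fun z => D z * (D z - T' z)) := ctnM cD (ctnD cD (ctnN cT')).
have nD x : 0 < x -> 0 < cross (b - a) (d - c) * (x * cross (b - a) (d - c)).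
  by move=> x0; rewrite mulrCA -expr2 mulr_gt0.
have nD' x : x < 1 -> 0 < cross (b - a) (d - c) *
    (cross (b - a) (d - c) - x * cross (b - a) (d - c)).
  by move=> x1; rewrite -{2}[cross _ _]mul1r -mulrBl nD // subr_gt0.
have := stable_positive c1; have := stable_positive c2.
have := stable_positive c3; have := stable_positive c4.
move=> s4 s3 s2 s1.
have {}s1 := s1 ltac:(by move=> *; rewrite DE TE; exact: nD).
have {}s2 := s2 ltac:(by move=> *; rewrite DE T'params; exact: nD).
have {}s3 := s3 ltac:(by move=> *; rewrite DE TE; exact: nD').
have {}s4 := s4 ltac:(by move=> *; rewrite DE T'params; exact: nD').
apply: filterS (filterI (filterI s1 s2) (filterI s3 s4)).
move=> e [[p1 p2] [p3 p4]] r1 r2 h1 h2; apply: cross_onceP.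
have z01 : 0 <= (0 : R) <= 1 by rewrite lexx ler01.
have {}p1 := p1 _ _ _ _ _ _ h1 h2 h2 z01 z01 z01.
have {}p2 := p2 _ _ _ _ _ _ h1 h2 h2 z01 z01 z01.
have {}p3 := p3 _ _ _ _ _ _ h1 h2 h2 z01 z01 z01.
have {}p4 := p4 _ _ _ _ _ _ h1 h2 h2 z01 z01 z01.
have DE' : cross (b + r1 *: mb - (a + r1 *: ma)) (d + r2 *: md - (c + r2 *: mc))
   = D (0, 0, 0, (r1, r2, r2)) by rewrite /D /dif /cross !pairE.
have TE' : cross (c + r2 *: mc - (a + r1 *: ma)) (d + r2 *: md - (c + r2 *: mc))
   = T (0, 0, 0, (r1, r2, r2)) by rewrite /T /dif /mov /cross !pairE.
have T'params' : cross (c + r2 *: mc - (a + r1 *: ma)) (b + r1 *: mb - (a + r1 *: ma))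
   = T' (0, 0, 0, (r1, r2, r2)) by rewrite /T' /dif /mov /cross !pairE.
by rewrite DE' TE' T'params'.
Qed.

End Stability.

(** * Polygonal chains and hairpins *)

Section Chains.
Variable R : realType.
Implicit Types (a b c d m : R * R) (s t e : R) (p q n : nat -> R * R).

Definition edge p (i : nat) t := between (p i) (p i.+1) t.

Definition chain p (N : nat) : set (R * R) :=
  [set x | exists i t, [/\ (i < N)%N, 0 <= t <= 1 & x = edge p i t]].

(* The concatenation of the first [N] edges, with edge [i] run through during
   the time interval [[i, i + 1]], is injective. *)
Definition simple_chain p (N : nat) := forall i j t t',
  (i < N)%N -> (j < N)%N -> 0 <= t <= 1 -> 0 <= t' <= 1 ->
  edge p i t = edge p j t' -> i%:R + t = j%:R + t'.

(** Only vertices are moved, linearly in [s]. A moved edge need not be parallel to the old one, but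
    consecutive moved edges still share a vertex without any trimming. *)
Definition offset p n s := fun i => p i + s *: n i.

Definition left_normals p n (N : nat) := forall i, (i < N)%N ->
  0 < cross (p i.+1 - p i) (n i) /\ 0 < cross (p i.+1 - p i) (n i.+1).

Let i0 : 0 <= (0 : R) <= 1. Proof. by rewrite lexx ler01. Qed.
Let i1 : 0 <= (1 : R) <= 1. Proof. by rewrite lexx ler01. Qed.

Lemma simple_chain_neq p N i : simple_chain p N -> (i < N)%N -> p i <> p i.+1.
Proof.
move=> sp iN e.
have := sp i i 0 1 iN iN i0 i1.
by rewrite /edge between0 between1 => /(_ e); lra.
Qed.

Lemma simple_chain_turn p N i r : simple_chain p N -> (i.+1 < N)%N -> 0 < r ->
  p i.+2 - p i.+1 <> - (r *: (p i.+1 - p i)).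
Proof.
move=> sp iN r0 e.
have r1 : 0 < 1 + r by lra.
(* The solution of [t' = 1 - r * t']: at this parameter an edge and a next edge running back along
   it are at the same point. *)
pose t' := (1 + r)^-1.
have t'0 : 0 < t' by rewrite invr_gt0.
have rt : r * t' = 1 - t' by rewrite /t'; field; rewrite gt_eqF.
have t'1 : t' < 1 by have := mulr_gt0 r0 t'0; lra.
have := sp i i.+1 t' t' (ltnW iN) iN.
have -> : edge p i t' = edge p i.+1 t'.
  rewrite /edge {2}/between e.
  have -> : p i.+1 + t' *: - (r *: (p i.+1 - p i)) = between (p i) (p i.+1) (1 - r * t').
    by apply: eq_pair; rewrite /between !pairE /=; ring.
  by rewrite rt opprB addrC subrK.
have t'i : 0 <= t' <= 1 by rewrite !ltW.
by move=> /(_ t'i t'i erefl); rewrite -natr1; lra.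
Qed.

Lemma left_normals_exist p N : simple_chain p N -> exists n, left_normals p n N.
Proof.
move=> sp.
have pos d : d <> 0 -> exists m, 0 < cross d m.
  move=> d0; have [r r0 e|m [h _]] := @common_normal R d d d0 d0; last by exists m.
  apply: d0; case: d e => [x y] e; move: e; rewrite !pairE /= => -[e1 e2].
  by congr pair; apply: (mulfI (lt0r_neq0 (addr_gt0 ltr01 r0))); lra.
have dn i : (i < N)%N -> p i.+1 - p i <> 0.
  by move=> iN /subr0_eq/esym; exact: simple_chain_neq iN.
(* The vector is chosen vertex by vertex, with one condition for the outgoing and one for the
   incoming edge; the bounds leave only one of them at each end of the chain. *)
have : forall i, exists m, ((i < N)%N -> 0 < cross (p i.+1 - p i) m) /\
    ((0 < i <= N)%N -> 0 < cross (p i - p i.-1) m).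
  move=> [|i].
    have [N0|N0] := ltnP 0 N; last by exists 0.
    by have [m h] := pos _ (dn _ N0); exists m.
  have [iN|iN] := ltnP i N; last by exists 0; split => // /ltnW; rewrite ltnNge iN.
  have [iN'|iN'] := ltnP i.+1 N; last by have [m h] := pos _ (dn _ iN); exists m.
  have [r r0|m [h1 h2]] := common_normal (dn _ iN) (dn _ iN').
    exact: (simple_chain_turn sp iN' r0).
  by exists m.
move=> /choice[n nP]; exists n => i iN; split; first by apply: (nP i).1.
by apply: (nP i.+1).2.
Qed.

(** Injectivity of the parametrization of the strip by displacement and time. Times [i + t] are
    compared rather than pairs, since a vertex between two edges has two such pairs. *)
Definition strip_injective_at p n (N : nat) e := forall s s' i j t t',
  (i < N)%N -> (j < N)%N -> 0 <= s <= e -> 0 <= s' <= e ->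
  0 <= t <= 1 -> 0 <= t' <= 1 ->
  edge (offset p n s) i t = edge (offset p n s') j t' ->
  s = s' /\ i%:R + t = j%:R + t'.

(** Taking [cross] with the direction [v] of the edge at displacement [s'] removes the motion along
    the edge. What remains is [s - s'] times a convex combination of [cross v m] and [cross v m'],
    both positive for small displacements. *)
Lemma strip_same_edge a b m m' :
    0 < cross (b - a) m -> 0 < cross (b - a) m' ->
  \forall e \near 0^'+, forall s s' t t',
    0 <= s <= e -> 0 <= s' <= e -> 0 <= t <= 1 -> 0 <= t' <= 1 ->
    between (a + s *: m) (b + s *: m') t = between (a + s' *: m) (b + s' *: m') t' ->
    s = s' /\ t = t'.
Proof.
move=> h1 h2.
have := stable_cross_gt0 (m' - m) 0 h1; have := stable_cross_gt0 (m' - m) 0 h2.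
apply: filterS2 => e p2 p1 s s' t t' se s'e t01 t'01 eq.
have {}p1 := p1 _ _ s'e se; have {}p2 := p2 _ _ s'e se.
rewrite !scaler0 !addr0 in p1 p2.
set v := b - a + _ in p1 p2.
have vE : (s - s') *: (m + t *: (m' - m)) = - ((t - t') *: v).
  move: eq; rewrite /v /between !pairE /= => -[e1 e2].
  by apply: eq_pair => /=; lra.
have ss : s = s'.
  have : (s - s') * (cross v m * (1 - t) + cross v m' * t) = 0.
    rewrite (_ : _ * _ = cross v ((s - s') *: (m + t *: (m' - m)))).
      by rewrite vE /cross !pairE /=; ring.
    by rewrite /cross !pairE /=; ring.
  move=> /eqP; rewrite mulf_eq0 => /orP[/eqP|/eqP z]; first by lra.
  have [t0 t1] := andP t01.
  have [z1 z2] : 0 <= cross v m * (1 - t) /\ 0 <= cross v m' * t.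
    by split; apply: mulr_ge0; lra.
  have /eqP : cross v m' * t = 0 by lra.
  have /eqP : cross v m * (1 - t) = 0 by lra.
  by rewrite !mulf_eq0 (gt_eqF p1) (gt_eqF p2) => /eqP ? /eqP ?; lra.
split=> //; move: vE; rewrite ss subrr scale0r => /eqP.
rewrite eq_sym oppr_eq0 scaler_eq0 => /orP[/eqP|/eqP v0]; first by lra.
by move: p1; rewrite v0 /cross /= !mul0r subrr ltxx.
Qed.

(** As [m'] lies to the left of both edges, [cross (x - b) m'] is at most 0 for [x] on the first
    strip and at least 0 on the second, with equality only on the track of the moved vertex. *)
Lemma strip_adjacent_edges a b c m m' m'' :
    0 < cross (b - a) m' -> 0 < cross (c - b) m' ->
  \forall e \near 0^'+, forall s s' t t',
    0 <= s <= e -> 0 <= s' <= e -> 0 <= t <= 1 -> 0 <= t' <= 1 ->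
    between (a + s *: m) (b + s *: m') t =
      between (b + s' *: m') (c + s' *: m'') t' ->
    [/\ s = s', t = 1 & t' = 0].
Proof.
move=> h1 h2.
have := stable_cross_gt0 (- m) 0 h1; have := stable_cross_gt0 m'' 0 h2.
apply: filterS2 => e p2 p1 s s' t t' se s'e t01 t'01 eq.
have {}p1 := p1 _ _ se se; have {}p2 := p2 _ _ s'e se.
rewrite !scaler0 !addr0 in p1 p2.
have [t0 t1] := andP t01; have [t'0 t'1] := andP t'01.
(* The line through [b] with direction [m'] separates the two strips. *)
have z : (1 - t) * cross (b - a + s *: - m) m' +
    t' * cross (c - b + s' *: m'') m' = 0.
  have : cross (between (a + s *: m) (b + s *: m') t - b) m' =
    cross (between (b + s' *: m') (c + s' *: m'') t' - b) m' by rewrite eq.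
  by rewrite /between /cross !pairE /=; lra.
have [z1 z2] : 0 <= (1 - t) * cross (b - a + s *: - m) m' /\
    0 <= t' * cross (c - b + s' *: m'') m'.
  by split; apply: mulr_ge0; lra.
have /eqP : (1 - t) * cross (b - a + s *: - m) m' = 0 by lra.
rewrite mulf_eq0 (gt_eqF p1) orbF subr_eq0 => /eqP te.
have /eqP : t' * cross (c - b + s' *: m'') m' = 0 by lra.
rewrite mulf_eq0 (gt_eqF p2) orbF => /eqP t'e.
split=> //; move: eq; rewrite -te t'e between0 between1 => /addrI /eqP.
rewrite -subr_eq0 -scalerBl scaler_eq0 subr_eq0 => /orP[/eqP //|/eqP m0].
by move: p1; rewrite m0 /cross /= !mulr0 subrr ltxx.
Qed.

Lemma strip_injective p n N : simple_chain p N -> left_normals p n N ->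
  \forall e \near 0^'+, strip_injective_at p n N e.
Proof.
move=> sp ln.
have H (i j : 'I_N) : (i <= j)%N -> \forall e \near 0^'+, forall s s' t t',
    0 <= s <= e -> 0 <= s' <= e -> 0 <= t <= 1 -> 0 <= t' <= 1 ->
    edge (offset p n s) i t = edge (offset p n s') j t' ->
    s = s' /\ i%:R + t = j%:R + t'.
  move=> ij; have [l1 l2] := ln _ (ltn_ord i); have [l3 l4] := ln _ (ltn_ord j).
  have [e|ne] := eqVneq (nat_of_ord i) j.
    have := strip_same_edge l1 l2; apply: filterS => e0 h s s' t t' h1 h2 h3 h4.
    by rewrite -e => /(h _ _ _ _ h1 h2 h3 h4)[-> ->].
  have [e|ne'] := eqVneq (nat_of_ord j) i.+1.
    rewrite e in l3 *.
    have := strip_adjacent_edges (n i) (n i.+2) l2 l3.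
    apply: filterS => e0 h s s' t t' h1 h2 h3 h4.
    by move=> /(h _ _ _ _ h1 h2 h3 h4)[-> -> ->]; rewrite -natr1 addr0.
  have := @stable_disjoint R (p i) (p i.+1) (n i) (n i.+1) (p j) (p j.+1) (n j) (n j.+1).
  (* Here [j] is at least [i + 2], so the times on the two edges differ and simplicity makes the
     edges disjoint. *)
  have dis t1 t2 : 0 <= t1 <= 1 -> 0 <= t2 <= 1 -> edge p i t1 <> edge p j t2.
    move=> h1 h2 /(sp _ _ _ _ (ltn_ord i) (ltn_ord j) h1 h2).
    have : (i%:R + 2 : R) <= j%:R by rewrite -natrD ler_nat addn2 ltn_neqAle eq_sym ne' ltn_neqAle ne.
    lra.
  move=> /(_ dis); apply: filterS => e0 h s s' t t' h1 h2 h3 h4.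
  by move=> /h; case.
have : \forall e \near 0^'+, forall ij : 'I_N * 'I_N, (ij.1 <= ij.2)%N -> forall s s' t t',
    0 <= s <= e -> 0 <= s' <= e -> 0 <= t <= 1 -> 0 <= t' <= 1 ->
    edge (offset p n s) ij.1 t = edge (offset p n s') ij.2 t' ->
    s = s' /\ ij.1%:R + t = ij.2%:R + t'.
  apply: filter_forall => -[i j] /=.
  by have [ij|ij] := leqP i j; [apply: filterS (H i j ij) => e h _|near=> e].
apply: filterS => e h s s' i j t t' iN jN se s'e t01 t'01 eq.
have [ij|/ltnW ji] := leqP i j.
  exact: (h (Ordinal iN, Ordinal jN)).
by have [-> ->] := h (Ordinal jN, Ordinal iN) ji _ _ _ _ s'e se t'01 t01 (esym eq).
Unshelve. all: by end_near. Qed.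

(** Vertices 0 to N are those of [p]; vertices N + 1 to 2N + 1 are the moved ones, from index N down
    to 0. This gives 2N + 1 edges, edge N being the closing one, and the two copies are not joined
    at the start, so the result is an arc. *)
Definition hairpin p n N e (i : nat) :=
  if (i <= N)%N then p i else offset p n e (N.*2.+1 - i).

(* The three cases are the original arc, the closing edge, and the moved arc run
   backwards. *)
Lemma hairpin_edge p n N e i t : (0 < N)%N -> 0 < e -> 0 <= t <= 1 ->
    (i < N.*2.+1)%N ->
  exists j t' s, [/\ (j < N)%N, 0 <= t' <= 1, 0 <= s <= e,
    edge (hairpin p n N e) i t = edge (offset p n s) j t' &
    [\/ s = 0 /\ i%:R + t = j%:R + t',
        j%:R + t' = N%:R /\ i%:R + t = N%:R + s / e |
        s = e /\ i%:R + t = N.*2.+1%:R - (j%:R + t')]].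
Proof.
move=> N0 e0 t01 iN.
have [t0 t1] := andP t01.
have [ltiN|geiN] := ltnP i N.
  exists i, t, 0; split=> //; first by rewrite lexx ltW.
    by rewrite /edge /hairpin /offset ltiN (ltnW ltiN) !scale0r !addr0.
  by constructor 1.
have [eiN|neiN] := eqVneq i N.
  (* The closing edge is swept by vertex N, addressed as the end of edge N - 1, while the
     displacement [t * e] grows from 0 to [e]. *)
  rewrite eiN; exists N.-1, 1, (t * e); split.
  - by rewrite prednK.
  - exact: i1.
  - by rewrite mulr_ge0 ?(ltW e0) // ler_piMl // ltW.
  - rewrite /edge /hairpin between1 leqnn ltnn prednK // /offset.
    rewrite (_ : (N.*2.+1 - N.+1)%N = N) ?/between; last by rewrite subSS -addnn addnK.
    by congr (_ + _); rewrite [p N + _]addrC addrK scalerA.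
  - by constructor 2; rewrite natr1 prednK // mulfK ?gt_eqF.
have ltNi : (N < i)%N by rewrite ltn_neqAle eq_sym neiN.
(* Edge [i] leads from moved vertex 2N + 1 - i to moved vertex 2N - i: it is the moved edge 2N - i
   reversed. *)
exists (N.*2 - i)%N, (1 - t), e; split.
- by lia.
- by apply/andP; split; lra.
- by rewrite ltW //= lexx.
- rewrite /edge /hairpin (leqNgt i) ltNi (leqNgt i.+1) ltnS (ltnW ltNi) /= subSS.
  by rewrite betweenC subSn //; lia.
- by constructor 3; split=> //; rewrite -natr1 natrB; [lra|lia].
Qed.

Lemma edge_hairpin p n N e (b : bool) i t : (i < N)%N -> 0 <= t <= 1 ->
  chain (hairpin p n N e) N.*2.+1 (edge (offset p n (if b then e else 0)) i t).
Proof.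
move=> iN t01; case: b.
  exists (N.*2 - i)%N, (1 - t); split; first by lia.
    by have [? ?] := andP t01; apply/andP; split; lra.
  rewrite /edge /hairpin -subSn; last by lia.
  do 2 (case: leqP => [?|_]; first by lia).
  by rewrite betweenC; congr between; congr offset; lia.
exists i, t; split=> //; first by lia.
by rewrite /edge /hairpin /offset iN (ltnW iN) !scale0r !addr0.
Qed.

(** By strip injectivity a point determines its displacement [s] and its time T on the arc. These
    determine the time on the hairpin, which is T for [s = 0], N + s / e for T = N and 2N + 1 - T
    for [s = e]; the formulas agree where two of them apply. *)
Lemma hairpin_simple p n N e : (0 < N)%N -> 0 < e -> strip_injective_at p n N e ->
  simple_chain (hairpin p n N e) N.*2.+1.
Proof.
move=> N0 e0 inj i i' t t' iN i'N t01 t'01.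
have [j [u [s [jN u01 se -> alt]]]] := hairpin_edge p n N0 e0 t01 iN.
have [j' [u' [s' [j'N u'01 s'e -> alt']]]] := hairpin_edge p n N0 e0 t'01 i'N.
move=> /(inj _ _ _ _ _ _ jN j'N se s'e u01 u'01)[ess ejj].
have ee : e / e = 1 by rewrite divff ?gt_eqF.
have ndbl : N.*2.+1%:R = N%:R + N%:R + 1 :> R by rewrite -natr1 -addnn natrD.
rewrite ndbl in alt alt'; rewrite -{}ess in alt'.
case: alt => -[h1 h2]; case: alt' => -[h3 h4]; try by lra.
all: try by [rewrite h1 in h4; lra].
all: try by [rewrite h3 in h2; rewrite ?mul0r in h2; lra].
all: try by [rewrite h1 mul0r in h4; lra].
all: by [rewrite h1 ee in h4; lra | rewrite h3 ee in h2; lra].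
Qed.

End Chains.

(** * From chains to curves *)

Section ChainCurve.
Variable R : realType.
Implicit Types (q : nat -> R * R) (s t x : R).

Lemma nat_add_frac N x : (0 < N)%N -> 0 <= x <= N%:R ->
  exists i t, [/\ (i < N)%N, 0 <= t <= 1 & x = i%:R + t].
Proof.
elim: N => // N IH _ /andP[x0 xN].
have [xlt|xge] := leP x N%:R; last first.
  exists N, (x - N%:R); split=> //; last by lra.
  by rewrite -natr1 in xN; apply/andP; split; lra.
have [N0|N0] := posnP N.
  by exists 0%N, x; split; rewrite ?add0r // x0 (le_trans xlt) // N0.
have [|i [t [iN t01 xE]]] := IH N0; first by rewrite x0.
by exists i, t; split => //; exact: ltnW.
Qed.

(* [x] truncated to [[0, 1]]. *)
Let clamp x : R := (`|x| - `|x - 1| + 1) / 2.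

Let clamp_id x : 0 <= x <= 1 -> clamp x = x.
Proof.
move=> /andP[x0 x1]; rewrite /clamp ger0_norm // ler0_norm; first by field.
by lra.
Qed.

Let clamp_ge1 x : 1 <= x -> clamp x = 1.
Proof. by move=> x1; rewrite /clamp !ger0_norm; [field|lra|lra]. Qed.

Let clamp_le0 x : x <= 0 -> clamp x = 0.
Proof. by move=> x1; rewrite /clamp !ler0_norm; [field|lra|lra]. Qed.

Let clamp_continuous : continuous clamp.
Proof.
move=> x; apply: cvgM; last exact: cvg_cst.
apply: cvgD; last exact: cvg_cst.
apply: cvgB; apply: cvg_norm; first exact: cvg_id.
by apply: cvgB; [exact: cvg_id|exact: cvg_cst].
Qed.

(** Past edges contribute their full vector, the current one a fraction and later ones nothing. One
    closed formula yields continuity without gluing pieces. *)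
Definition polyline q (N : nat) x :=
  q 0%N + \sum_(0 <= i < N) clamp (x - i%:R) *: (q i.+1 - q i).

Lemma polylineE q N i t : (i < N)%N -> 0 <= t <= 1 ->
  polyline q N (i%:R + t) = edge q i t.
Proof.
move=> iN t01; have [t0 t1] := andP t01; rewrite /polyline.
rewrite (big_cat_nat (n := i)) //=; last exact: ltnW.
rewrite (big_cat_nat (n := i.+1) (m := i)) //= big_nat1.
have -> : i%:R + t - i%:R = t by lra.
rewrite clamp_id //.
under eq_big_nat => j /andP[_ ji].
  rewrite clamp_ge1 ?scale1r; first by over.
  have : (j%:R + 1 : R) <= i%:R by rewrite natr1 ler_nat.
  by lra.
rewrite [X in _ + (_ + (_ + X))]big1_seq ?addr0 => [|j]; last first.
  rewrite mem_index_iota /= => /andP[ij _].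
  rewrite clamp_le0 ?scale0r //.
  have : (i%:R + 1 : R) <= j%:R by rewrite natr1 ler_nat.
  by lra.
by rewrite telescope_sumr // /edge /between addrA; congr (_ + _); rewrite addrC subrK.
Qed.

Lemma polyline_continuous q N : continuous (polyline q N).
Proof.
move=> x; apply: cvgD; first exact: cvg_cst.
elim: N => [|N IH].
  rewrite (_ : (fun _ => _) = cst 0); first by rewrite big_geq //; exact: cvg_cst.
  by apply/funext => y; rewrite big_geq.
rewrite (_ : (fun _ => _) = fun y => \sum_(0 <= i < N) clamp (y - i%:R) *: (q i.+1 - q i)
    + clamp (y - N%:R) *: (q N.+1 - q N)); last first.
  by apply/funext => y; rewrite big_nat_recr.
rewrite big_nat_recr //=; apply: cvgD => //; apply: cvgZ; last exact: cvg_cst.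
have /= := @continuous_comp _ _ _ (fun y : R => y - N%:R) clamp x; apply.
  by apply: cvgB; [exact: cvg_id|exact: cvg_cst].
exact: clamp_continuous.
Qed.

(** The polyline is run through at speed N to fit the unit interval. Bends are only included in the
    vertex set, since consecutive edges may be aligned. *)
Lemma simple_chain_curve q N : (0 < N)%N -> simple_chain q N ->
  exists g : R -> R * R, [/\ is_curve g, simple_curve g, piecewise_linear g,
    trace g = chain q N &
    bends g `|` endpoints g `<=` [set q i | i in [set i | (i <= N)%N]]].
Proof.
move=> N0 sq; pose g t := polyline q N (N%:R * t).
have Np : 0 < N%:R :> R by rewrite ltr0n.
have Nn : N%:R != 0 :> R by rewrite gt_eqF.
have inN t : 0 <= t <= 1 -> 0 <= N%:R * t <= N%:R.
  by move=> /andP[t0 t1]; rewrite mulr_ge0 ?(ltW Np) //= ler_piMr // ltW.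
have gE i s : (i < N)%N -> 0 <= s <= 1 -> g ((i%:R + s) / N%:R) = edge q i s.
  by move=> iN s01; rewrite /g mulrC divfK // polylineE.
have frac t : 0 <= t <= 1 -> exists i s,
    [/\ (i < N)%N, 0 <= s <= 1, t = (i%:R + s) / N%:R & g t = edge q i s].
  move=> /inN/(nat_add_frac N0)[i [s [iN s01 e]]]; exists i, s.
  have et : t = (i%:R + s) / N%:R by rewrite -e mulrC mulKf.
  by split=> //; rewrite et gE.
have cg : continuous g.
  move=> t; have /= := @continuous_comp _ _ _ (fun y : R => N%:R * y) (polyline q N) t; apply.
    exact: mulrl_continuous.
  exact: polyline_continuous.
exists g; split.
- exact: continuous_subspaceT.
- move=> x y; rewrite !inE /= !in_itv /= => /frac[i [s [iN s01 -> ->]]].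
  move=> /frac[j [t [jN t01 -> ->]]] e.
  by rewrite (sq _ _ _ _ iN jN s01 t01 e).
- pose f j : R := j%:R / N%:R.
  exists [seq f j | j <- iota 1 N].
  have E : 0 :: [seq f j | j <- iota 1 N] = [seq f j | j <- iota 0 N.+1].
    by rewrite /= /f mul0r.
  split.
    split.
      rewrite -[path _ _ _]/(sorted <%R (0 :: _)) E sorted_map.
      apply: sub_sorted (iota_ltn_sorted 0 N.+1) => i j /= ij.
      by rewrite /f ltr_pM2r ?invr_gt0 // ltr_nat.
    rewrite -nth_last size_map size_iota (set_nth_default 0) ?size_map ?size_iota ?prednK //.
    by rewrite (nth_map 0%N) ?size_iota ?prednK // nth_iota ?prednK // add1n prednK // /f divff.
  move=> i; rewrite size_map size_iota => iN.
  rewrite E (nth_map 0%N) ?size_iota ?ltnS ?(ltnW iN) // nth_iota ?ltnS ?(ltnW iN) //.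
  rewrite (nth_map 0%N) ?size_iota // nth_iota // add0n add1n /f.
  exists (q i - i%:R *: (q i.+1 - q i)), (N%:R *: (q i.+1 - q i)) => t.
  rewrite ler_pdivrMr // ler_pdivlMr // -natr1 => /andP[h1 h2].
  have -> : t = (i%:R + (N%:R * t - i%:R)) / N%:R by field.
  rewrite gE //; last by apply/andP; split; lra.
  by apply: eq_pair; rewrite /edge /between !pairE /=; field.
- apply/seteqP; split=> [_ /= [t + <-]|_ /= [i [s [iN s01 ->]]]].
    rewrite /= in_itv /= => /frac[i [s [iN s01 _ ->]]].
    by exists i, s.
  exists ((i%:R + s) / N%:R); last exact: gE.
  rewrite /= in_itv /=; have [s0 s1] := andP s01.
  have : (i%:R + 1 : R) <= N%:R by rewrite natr1 ler_nat.
  by rewrite divr_ge0 ?addr_ge0 //= ler_pdivrMr // mul1r; lra.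
- move=> _ [[t [t01 ns] <-]|[->|->]].
  + have t01' : 0 <= t <= 1 by have [? ?] := andP t01; rewrite !ltW.
    have [i [s [iN s01 et ->]]] := frac _ t01'.
    have [s0|s0] := eqVneq s 0.
      by exists i; rewrite /= ?(ltnW iN) // s0 /edge between0.
    have [s1|s1] := eqVneq s 1.
      by exists i.+1; rewrite /= // s1 /edge between1.
    (* Strictly inside an edge the direction of this edge witnesses straightness. *)
    case: ns; exists (q i.+1 - q i).
    have Nt : N%:R * t = i%:R + s by rewrite et mulrC divfK.
    have lo : i%:R / N%:R < t.
      by rewrite ltr_pdivrMr // mulrC Nt ltrDl lt_neqAle eq_sym s0; case/andP: s01.
    have hi : t < i.+1%:R / N%:R.
      by rewrite ltr_pdivlMr // mulrC Nt -natr1 ltrD2l lt_neqAle s1; case/andP: s01.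
    near=> r; exists (N%:R * (r - t)).
    have r1 : i%:R / N%:R < r by near: r; exact: (@cvgr_gt _ _ (nbhs t) _ id t cvg_id).
    have r2 : r < i.+1%:R / N%:R by near: r; exact: lt_nbhsl.
    have -> : r = (i%:R + (N%:R * r - i%:R)) / N%:R by field.
    move: r1 r2; rewrite ltr_pdivrMr // ltr_pdivlMr // -natr1 => r1 r2.
    rewrite gE //; last by apply/andP; split; lra.
    have -> : g t = edge q i (N%:R * t - i%:R).
      by rewrite Nt [X in edge _ _ X](_ : _ = s); [rewrite et gE|lra].
    by apply: eq_pair; rewrite /edge /between !pairE /=; field.
  + exists 0%N => //; have := gE 0%N 0 N0; rewrite addr0 mul0r => ->.
      by rewrite /edge between0.
    by rewrite lexx ler01.
  + have lt1 : (N.-1 < N)%N by rewrite prednK.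
    have := gE _ 1 lt1; rewrite lexx ler01 => /(_ erefl).
    rewrite natr1 (prednK N0) (divff Nn) => ->.
    by exists N => //=; rewrite /edge between1 (prednK N0).
Unshelve. all: by end_near. Qed.

End ChainCurve.

(** * From curves to chains *)

Section CurveChain.
Variable R : realType.
Implicit Types (p : nat -> R * R) (g : R -> R * R) (a b c s t x y : R).

Lemma affine_between g a b t : affine_on g a b -> a < b -> 0 <= t <= 1 ->
  g (a + t * (b - a)) = between (g a) (g b) t.
Proof.
move=> [p [d gE]] ab /andP[t0 t1].
have h1 : 0 <= t * (b - a) by rewrite mulr_ge0 // subr_ge0 ltW.
have h2 : 0 <= (1 - t) * (b - a) by rewrite mulr_ge0 // subr_ge0 // ltW.
rewrite !gE; last 3 first.
- by apply/andP; split; lra.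
- by apply/andP; split; lra.
- by apply/andP; split; lra.
by apply: eq_pair; rewrite /between !pairE /=; ring.
Qed.

Lemma itv_param a b x : a < b -> a <= x <= b ->
  exists2 t, 0 <= t <= 1 & x = a + t * (b - a).
Proof.
move=> ab /andP[ax xb]; have ba : 0 < b - a by rewrite subr_gt0.
exists ((x - a) / (b - a)); last by rewrite divfK ?gt_eqF //; lra.
by rewrite divr_ge0 ?ler_pdivrMr ?mul1r ?lerD2r //; lra.
Qed.

(** Near [b] both pieces lie on one line, so their directions are proportional; a negative ratio
    would make the curve run back over itself. *)
Lemma straight_join g a b b' : simple_curve g -> 0 <= a -> a < b -> b < b' ->
    b' <= 1 -> affine_on g a b -> affine_on g b b' -> straight_at g b ->
  exists2 r, 0 < r & g b' - g b = r *: (g b - g a).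
Proof.
move=> sg a0 ab bb' b'1 f1 f2 [d sd].
have inj x y : 0 <= x <= 1 -> 0 <= y <= 1 -> g x = g y -> x = y.
  by move=> hx hy; apply: sg; rewrite inE /= in_itv.
have D1 : g b - g a != 0.
  rewrite subr_eq0; apply/eqP => /inj e.
  suff : b = a by lra.
  by apply: e; apply/andP; split; lra.
have D2 : g b' - g b != 0.
  rewrite subr_eq0; apply/eqP => /inj e.
  suff : b' = b by lra.
  by apply: e; apply/andP; split; lra.
have [e /= e0 eb] := (nbhs_ballP _ _).1 sd.
(* The pieces have parameter length at most 1, so moving by the fraction [h] of either piece away
   from [b] stays within distance [e] of [b]. *)
pose h := Num.min (2^-1) (e / 2).
have h0 : 0 < h by rewrite lt_min invr_gt0 ltr0n divr_gt0.
have h1 : h <= 2^-1 by rewrite ge_min lexx.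
have he : h <= e / 2 by rewrite ge_min lexx orbT.
have h11 : 0 <= h <= 1 by rewrite ltW //=; lra.
have h12 : 0 <= 1 - h <= 1 by apply/andP; split; lra.
have [c1 E1] : exists c, g b - h *: (g b - g a) = g b + c *: d.
  have [|c E] := eb (a + (1 - h) * (b - a)).
    rewrite -ball_normE /ball_ /= (_ : _ - _ = h * (b - a)); last by ring.
    rewrite ger0_norm ?mulr_ge0 ?(ltW h0) //; last by lra.
    have : h * (b - a) <= h * 1 by rewrite ler_wpM2l ?(ltW h0) //; lra.
    by lra.
  exists c; rewrite -E affine_between //.
  by apply: eq_pair; rewrite /between !pairE /=; ring.
have [c2 E2] : exists c, g b + h *: (g b' - g b) = g b + c *: d.
  have [|c E] := eb (b + h * (b' - b)).
    rewrite -ball_normE /ball_ /= (_ : _ - _ = - (h * (b' - b))); last by ring.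
    rewrite normrN ger0_norm ?mulr_ge0 ?(ltW h0) //; last by lra.
    have : h * (b' - b) <= h * 1 by rewrite ler_wpM2l ?(ltW h0) //; lra.
    by lra.
  by exists c; rewrite -E affine_between.
move: E1 => /addrI E1; move: E2 => /addrI E2.
have hn : h != 0 by rewrite gt_eqF.
have c1n : c1 != 0.
  apply: contra_neq D1 => c10; apply/eqP; move: E1.
  by rewrite c10 scale0r => /eqP; rewrite oppr_eq0 scaler_eq0 (negbTE hn).
pose r := - (c2 / c1).
have rE : g b' - g b = r *: (g b - g a).
  apply: (scalerI hn); rewrite E2 scalerA mulrC -scalerA.
  rewrite -[h *: (g b - g a)]opprK E1 scalerN scalerA -scaleNr.
  by rewrite /r mulNr opprK divfK.
exists r => //.
have rn : r != 0.
  by apply: contra_neq D2 => r0; rewrite rE r0 scale0r.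
rewrite ltNge; apply/negP => rle; have {rle rn}r0 : r < 0 by rewrite lt_neqAle rn.
have q0 : 0 < 1 - r by lra.
(* The solution of [h2 = 1 + r * h2]: with [r] negative, both pieces reach the same point at this
   fraction. *)
pose h2 := (1 - r)^-1.
have h20 : 0 < h2 by rewrite invr_gt0.
have h2r : r * h2 = h2 - 1 by rewrite /h2; field; rewrite gt_eqF.
have rh2 : r * h2 < 0 by rewrite nmulr_rlt0.
have : a + h2 * (b - a) + (1 - h2) * 0 = b + h2 * (b' - b).
  rewrite mulr0 addr0; apply: inj.
  - have : 0 <= h2 * (b - a) by rewrite mulr_ge0 ?(ltW h20) //; lra.
    have : h2 * (b - a) <= 1 * (b - a) by rewrite ler_wpM2r //; lra.
    by move=> ? ?; apply/andP; split; lra.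
  - have : 0 <= h2 * (b' - b) by rewrite mulr_ge0 ?(ltW h20) //; lra.
    have : h2 * (b' - b) <= 1 * (b' - b) by rewrite ler_wpM2r //; lra.
    by move=> ? ?; apply/andP; split; lra.
  rewrite !affine_between //; try by apply/andP; split; lra.
  rewrite [RHS]/between rE scalerA mulrC h2r.
  by apply: eq_pair; rewrite /between !pairE /=; ring.
have : 0 < h2 * (b' - b) by rewrite mulr_gt0 //; lra.
have : h2 * (b - a) <= 1 * (b - a) by rewrite ler_wpM2r //; lra.
by lra.
Qed.

(* Subdivision points lying in [X] are not bends, so that the two adjacent edges
   can be merged. *)
Lemma curve_chain_from g (X : set (R * R)) (s : seq R) a :
    simple_curve g -> (forall z, (bends g `|` endpoints g) z -> ~ X z) ->
    0 <= a -> (0 < size s)%N -> path <%R a s -> last a s = 1 ->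
    (forall i, (i < size s)%N -> affine_on g (nth 0 (a :: s) i) (nth 0 s i)) ->
  exists N p, [/\ (0 < N)%N, simple_chain p N, chain p N = g @` `[a, 1],
     (forall i, (0 < i <= N)%N -> ~ X (p i)) &
     p 0%N = g a /\ exists2 c, 0 < c & p 1%N - p 0%N = c *: (g (head 0 s) - g a)].
Proof.
move=> sg bX; elim: s a => // b s IH a a0 _ /= /andP[ab pbs] lst aff.
have affab : affine_on g a b by exact: (aff 0%N).
have inj x y : 0 <= x <= 1 -> 0 <= y <= 1 -> g x = g y -> x = y.
  by move=> hx hy; apply: sg; rewrite inE /= in_itv.
have b1 : b <= 1 by apply: (@itv_partition_le _ _ _ _ s); split=> //; apply/eqP.
have gab : g a <> g b.
  by move=> /inj e; have : a = b by [apply: e; apply/andP; split; lra]; lra.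
have [s0|sn] := posnP (size s).
  have {s0 pbs IH}e : b = 1 by move: lst; rewrite (size0nil s0).
  subst b; exists 1%N, (fun i => if i is 0%N then g a else g 1); split=> //.
  - move=> [|//] [|//] t t' _ _ h1 h2; rewrite /edge => /(between_inj gab) ->.
    by [].
  - apply/seteqP; split=> [_ [i [t [iN t01 ->]]]|_ [y /= + <-]].
      case: i iN => // _; rewrite /edge -affine_between //; exists (a + t * (1 - a)) => //=.
      have [t0 t1] := andP t01.
      have : 0 <= t * (1 - a) by rewrite mulr_ge0 //; lra.
      have : 0 <= (1 - t) * (1 - a) by rewrite mulr_ge0 //; lra.
      by move=> ? ?; rewrite in_itv /=; apply/andP; split; lra.
    rewrite in_itv /= => /(itv_param ab)[t t01 ->].
    by exists 0%N, t; split=> //; rewrite affine_between.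
  - by move=> [//|i] _; apply: bX; right; right.
  - by split=> //; exists 1; rewrite // scale1r.
(* The first edge of the chain from [b] may already unite several pieces; the factor [c] records
   that it keeps the direction of the first one. Vertex 0 is exempt from avoiding [X], because it
   can still disappear in a merge. *)
have [N [p [N0 sp cp pX [p0 [c c0 p1]]]]] := IH b (ltW (le_lt_trans a0 ab)) sn pbs lst
  (fun i iN => aff i.+1 iN).
have bN : b < 1.
  by case: (s) sn pbs lst => //= b' s' _ /andP[bb' pb'] l;
    apply: (lt_le_trans bb'); apply: (@itv_partition_le _ _ _ _ s'); split=> //; apply/eqP.
have i0 : 0 <= (0 : R) <= 1 by rewrite lexx ler01.
have chain_right j t : (j < N)%N -> 0 <= t <= 1 ->
    exists2 y, b <= y <= 1 & edge p j t = g y.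
  move=> jN t01; have : (g @` `[b, 1]) (edge p j t) by rewrite -cp; exists j, t.
  by case=> y; rewrite /= in_itv /= => y1 <-; exists y.
have first_left t : 0 <= t <= 1 ->
    exists2 x, a <= x <= b & between (g a) (g b) t = g x.
  move=> t01; rewrite -affine_between //; exists (a + t * (b - a)) => //.
  have [t0 t1] := andP t01.
  have : 0 <= t * (b - a) by rewrite mulr_ge0 //; lra.
  have : 0 <= (1 - t) * (b - a) by rewrite mulr_ge0 //; lra.
  by move=> ? ?; apply/andP; split; lra.
have meet t j t' : 0 <= t <= 1 -> (j < N)%N -> 0 <= t' <= 1 ->
    between (g a) (g b) t = edge p j t' ->
    between (g a) (g b) t = g b /\ j%:R + t' = 0.
  move=> t01 jN t'01 e.
  have [x xab e1] := first_left t t01; have [y yb e2] := chain_right j t' jN t'01.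
  have [xa xb] := andP xab; have [yb1 y1] := andP yb.
  have xy : x = y by apply: inj; [apply/andP; split; lra..|rewrite -e1 -e2].
  have xe : x = b by lra.
  split; first by rewrite e1 xe.
  have := sp _ _ _ _ jN N0 t'01 i0; rewrite addr0 => -> //.
  by rewrite -e e1 xe /edge between0 p0.
have inN (j : nat) t : 0 <= t -> j%:R + t = 0 :> R -> j = 0%N /\ t = 0.
  move=> t0 h; have j0 : 0 <= j%:R :> R by [].
  split; last by lra.
  by apply/eqP; rewrite -(pnatr_eq0 R); apply/eqP; lra.
have split_itv y : a <= y <= 1 -> a <= y <= b \/ b <= y <= 1.
  by move=> /andP[ya y1]; have [yb|yb] := leP y b; [left|right]; rewrite ?ya ?y1 // ltW.
have [Xb|nXb] := pselect (X (g b)); last first.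
  exists N.+1, (fun i => if i is j.+1 then p j else g a); split=> //.
  - move=> [|i] [|j] t t' iN jN t01 t'01; rewrite /edge.
    + by rewrite p0 => /(between_inj gab) ->.
    + rewrite p0 => /(meet _ _ _ t01 jN t'01)[e jt].
      have t1 : t = 1 by apply: (between_inj gab); rewrite e between1.
      by rewrite t1 -[j.+1%:R]natr1; lra.
    + rewrite p0 => /esym/(meet _ _ _ t'01 iN t01)[e jt].
      have t1 : t' = 1 by apply: (between_inj gab); rewrite e between1.
      by rewrite t1 -[i.+1%:R]natr1; lra.
    + by rewrite -!natr1 => /(sp _ _ _ _ iN jN t01 t'01); lra.
  - apply/seteqP; split=> [_ [[|j] [t [jN t01 ->]]]|_ [y /= + <-]].
    + rewrite /edge p0; have [x xab ->] := first_left t t01.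
      by exists x => //=; rewrite in_itv /=; case/andP: xab => -> /= /le_trans; apply.
    + rewrite -[edge _ _ _]/(edge p j t); have [y yb ->] := chain_right j t jN t01.
      by exists y => //=; rewrite in_itv /=; case/andP: yb => /(le_trans (ltW ab)) -> ->.
    + rewrite in_itv /= => /split_itv[/(itv_param ab)[t t01 ->]|yb].
        by exists 0%N, t; split=> //; rewrite affine_between // /edge p0.
      have : chain p N (g y) by rewrite cp; exists y => //=; rewrite in_itv.
      by case=> j [t [jN t01 ->]]; exists j.+1, t.
  - move=> [//|[_|i iN]]; first by rewrite p0.
    exact: pX.
  - by split=> //; exists 1; rewrite // p0 scale1r.
have [r r0 rE] : exists2 r, 0 < r & g (head 0 s) - g b = r *: (g b - g a).
  case: (s) sn pbs lst aff => //= b' s' _ /andP[bb' pb'] l aff'.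
  have b'1 : b' <= 1 by apply: (@itv_partition_le _ _ _ _ s'); split=> //; apply/eqP.
  apply: (@straight_join _ a) => //; first exact: (aff' 1%N).
  apply: contrapT => ns; apply: bX Xb; left; exists b => //=; split=> //.
  by rewrite bN andbT; exact: le_lt_trans ab.
have cr0 : 0 < 1 + c * r by have := mulr_gt0 c0 r0; lra.
(* The parameter of [g b] on the merged edge from [g a] to [p 1], which is [1 + c * r] times as long
   as the piece from [g a] to [g b]. *)
pose m := (1 + c * r)^-1.
have m0 : 0 < m by rewrite invr_gt0.
have crm : c * r * m = 1 - m by rewrite /m; field; rewrite gt_eqF.
have m1 : m < 1 by have := mulr_gt0 (mulr_gt0 c0 r0) m0; lra.
have mn : m != 0 by rewrite gt_eqF.
have m1n : 1 - m != 0 by rewrite subr_eq0 gt_eqF.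
have p1E : p 1%N = g b + (c * r) *: (g b - g a).
  by rewrite -scalerA -rE -p1 p0 addrC subrK.
have gbE : g b = between (g a) (p 1%N) m.
  apply: subr0_eq; rewrite p1E.
  rewrite (_ : _ - _ = (1 - m - c * r * m) *: (g b - g a)); first by rewrite crm subrr scale0r.
  by apply: eq_pair; rewrite /between !pairE /=; ring.
have lo t : between (g a) (p 1%N) (t * m) = between (g a) (g b) t.
  rewrite gbE; apply: eq_pair; rewrite /between !pairE /=; ring.
have hi t : between (g a) (p 1%N) (m + t * (1 - m)) = edge p 0 t.
  rewrite /edge p0 gbE; apply: eq_pair; rewrite /between !pairE /=; ring.
have cut t : 0 <= t <= 1 -> (exists2 u, 0 <= u <= 1 & t = u * m) \/
    (exists2 u, 0 <= u <= 1 & t = m + u * (1 - m)).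
  move=> /andP[t0 t1]; have [tm|mt] := leP t m.
    left; exists (t / m); last by rewrite divfK.
    by rewrite divr_ge0 ?(ltW m0) //= ler_pdivrMr // mul1r.
  right; exists ((t - m) / (1 - m)); last by rewrite divfK //; lra.
  by rewrite divr_ge0 ?ler_pdivrMr //=; lra.
have gap1 : g a <> p 1%N.
  move=> e; apply: gab; apply: subr0_eq; rewrite gbE -e betweenaa subrr.
  by [].
have sideways t j t' : 0 <= t <= 1 -> (j.+1 < N)%N -> 0 <= t' <= 1 ->
    between (g a) (p 1%N) t = edge p j.+1 t' -> t = j.+1%:R + t'.
  move=> t01 jN t'01; have [t'0 t'1] := andP t'01.
  have j0 : 0 <= j%:R :> R by [].
  have [[u u01 ->]|[u u01 ->]] := cut t t01.
    by rewrite lo => /(meet _ _ _ u01 jN t'01)[_]; rewrite -natr1; lra.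
  rewrite hi => /(sp _ _ _ _ N0 jN u01 t'01).
  rewrite -natr1 add0r; have [u0 u1] := andP u01 => e.
  have -> : u = 1 by lra.
  by rewrite mul1r; lra.
exists N, (fun i => if i is j.+1 then p j.+1 else g a); split=> //.
- move=> [|i] [|j] t t' iN jN t01 t'01; rewrite /edge.
  + by move=> /(between_inj gap1) ->.
  + by move=> /(sideways _ _ _ t01 jN t'01) ->; rewrite add0r.
  + by move=> /esym/(sideways _ _ _ t'01 iN t01) ->; rewrite add0r.
  + exact: sp.
- apply/seteqP; split=> [_ [[|j] [t [jN t01 ->]]]|_ [y /= + <-]].
  + rewrite /edge; have [[u u01 ->]|[u u01 ->]] := cut t t01.
      rewrite lo; have [x xab ->] := first_left u u01.
      by exists x => //=; rewrite in_itv /=; case/andP: xab => -> /= /le_trans; apply.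
    rewrite hi; have [y yb ->] := chain_right 0%N u N0 u01.
    by exists y => //=; rewrite in_itv /=; case/andP: yb => /(le_trans (ltW ab)) -> ->.
  + have [y yb] := chain_right j.+1 t jN t01; rewrite /edge => ->.
    by exists y => //=; rewrite in_itv /=; case/andP: yb => /(le_trans (ltW ab)) -> ->.
  + rewrite in_itv /= => /split_itv[/(itv_param ab)[t t01 ->]|yb].
      exists 0%N, (t * m); split=> //; last by rewrite affine_between // /edge lo.
      have [t0 t1] := andP t01; rewrite mulr_ge0 ?(ltW m0) //=.
      by rewrite mulr_ile1 ?(ltW m0) ?(ltW m1).
    have : chain p N (g y) by rewrite cp; exists y => //=; rewrite in_itv.
    case=> -[|j] [t [jN t01 ->]]; last by exists j.+1, t.
    exists 0%N, (m + t * (1 - m)); split=> //; last by rewrite -hi.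
    have [t0 t1] := andP t01.
    have : 0 <= t * (1 - m) by rewrite mulr_ge0 //; lra.
    have : 0 <= (1 - t) * (1 - m) by rewrite mulr_ge0 //; lra.
    by move=> ? ?; apply/andP; split; lra.
- by move=> [//|i]; exact: pX.
- split=> //; exists (1 + c * r) => //.
  by rewrite p1E; apply: eq_pair; rewrite !pairE /=; ring.
Qed.

(** The vertex 0 left open by the induction is now the endpoint [g 0], which avoids [X]. *)
Lemma curve_chain g (X : set (R * R)) : simple_curve g -> piecewise_linear g ->
    (forall z, (bends g `|` endpoints g) z -> ~ X z) ->
  exists N p, [/\ (0 < N)%N, simple_chain p N, chain p N = trace g &
    forall i, (i <= N)%N -> ~ X (p i)].
Proof.
move=> sg [s [[ps /eqP ls] aff]] bX.
have sn : (0 < size s)%N.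
  by case: s ps ls aff => //= _ /esym/eqP; rewrite oner_eq0.
have [N [p [N0 sp cp pX [p0 _]]]] := curve_chain_from sg bX (lexx 0) sn ps ls aff.
exists N, p; split=> // -[_|i iN]; last exact: pX.
by rewrite p0; apply: bX; right; left.
Qed.

End CurveChain.

(** * Counting crossings *)

Lemma card_eq_image_set (T : finType) (U : Type) (A : {set T}) (f : T -> U) :
  {in A &, injective f} -> (f @` [set` A] #= `I_#|A|)%card.
Proof.
move=> fi; apply: card_eq_trans (inj_card_eq _) _.
  by move=> x y; rewrite !inE; exact: fi.
have [->|/set0Pn[x0 Ax0]] := eqVneq A finset.set0.
  rewrite cards0 (_ : [set` _] = set0) ?II0 //.
  by apply/seteqP; split=> x //=; rewrite inE.
rewrite card_eq_sym (_ : [set` A] = nth x0 (enum A) @` `I_#|A|).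
  rewrite card_eq_sym; apply: inj_card_eq => i j; rewrite !inE /= => iA jA.
  by move/eqP; rewrite nth_uniq -?cardE // ?enum_uniq // => /eqP.
apply/seteqP; split=> [x /= xA|_ /= [i iA <-]]; last first.
  by rewrite -mem_enum mem_nth // -cardE.
by exists (index x (enum A)); rewrite /= ?cardE ?index_mem ?nth_index ?mem_enum.
Qed.

Lemma card_eq_nonempty (T : Type) (A : set T) m :
  (A #= `I_m)%card -> A !=set0 <-> (0 < m)%N.
Proof.
case: m => [|m] Am.
  split=> // -[x Ax]; move: Am; rewrite II0 card_eq0 => /eqP A0.
  by move: Ax; rewrite A0.
by split=> // _; apply/set0P; apply: contraL Am => /eqP ->;
  rewrite card_eq_sym card_eq0; apply/eqP => I0; have : `I_m.+1 0%N by []; rewrite I0.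
Qed.

Section Crossings.
Variable R : realType.
Implicit Types (s t e : R) (p n : nat -> R * R) (N : nat).

Definition strip p n N e : set (R * R) := [set x | exists s j t,
  [/\ (j < N)%N, 0 <= s <= e, 0 <= t <= 1 & x = edge (offset p n s) j t]].

Definition edges_meet p p' (i j : nat) := exists t t',
  [/\ 0 <= t <= 1, 0 <= t' <= 1 & edge p i t = edge p' j t'].

(** Which edges meet is decided at displacement 0 and stays the same for any two displacements,
    chosen independently because every copy of one arc is compared with every copy of the other. *)
Definition strips_cross_at p n N p' n' N' e := forall s s' i j,
  (i < N)%N -> (j < N')%N -> 0 <= s <= e -> 0 <= s' <= e ->
  (edges_meet p p' i j ->
    cross_once (offset p n s i) (offset p n s i.+1)
               (offset p' n' s' j) (offset p' n' s' j.+1)) /\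
  (~ edges_meet p p' i j -> forall t t', 0 <= t <= 1 -> 0 <= t' <= 1 ->
    edge (offset p n s) i t <> edge (offset p' n' s') j t').

(** The case [i = N] keeps the whole closing edge off the other strip; the remaining cases keep the
    vertices of a hairpin, and so its bends and endpoints, off the other curves. *)
Definition vertices_avoid_at p n N p' n' N' e := forall i s,
  (i <= N)%N -> 0 <= s <= e -> ~ strip p' n' N' e (offset p n s i).

Lemma offset0 p n : offset p n 0 = p.
Proof. by apply/funext => i; rewrite /offset scale0r addr0. Qed.

Lemma stable_strips3 p n N p' n' N' p'' n'' N'' :
    chain p N `&` chain p' N' `&` chain p'' N'' = set0 ->
  \forall e \near 0^'+,
    strip p n N e `&` strip p' n' N' e `&` strip p'' n'' N'' e = set0.
Proof.
move=> dis.
have : \forall e \near 0^'+, forall (i : 'I_N) (j : 'I_N') (k : 'I_N'') s1 s2 s3 t1 t2 t3,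
    0 <= s1 <= e -> 0 <= s2 <= e -> 0 <= s3 <= e ->
    0 <= t1 <= 1 -> 0 <= t2 <= 1 -> 0 <= t3 <= 1 ->
    edge (offset p n s1) i t1 = edge (offset p' n' s2) j t2 ->
    edge (offset p n s1) i t1 <> edge (offset p'' n'' s3) k t3.
  apply: filter_forall => i; apply: filter_forall => j; apply: filter_forall => k.
  apply: stable_disjoint3 => t1 t2 t3 h1 h2 h3 e1 e2.
  suff : (set0 : set (R * R)) (edge p i t1) by [].
  rewrite -dis; split; [split|]; first by exists i, t1.
    by exists j, t2.
  by exists k, t3.
apply: filterS => e h; apply/seteqP; split=> // x [[]].
move=> [s1 [i [t1 [iN hs1 ht1 ->]]]] [s2 [j [t2 [jN hs2 ht2 e2]]]].
move=> [s3 [k [t3 [kN hs3 ht3 e3]]]].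
exact: (h (Ordinal iN) (Ordinal jN) (Ordinal kN) s1 s2 s3 t1 t2 t3).
Qed.

Lemma stable_vertices p n N p' n' N' :
    (forall i, (i <= N)%N -> ~ chain p' N' (p i)) ->
  \forall e \near 0^'+, vertices_avoid_at p n N p' n' N' e.
Proof.
move=> av.
(* A vertex is treated as a segment with equal endpoints, so that [stable_disjoint] applies. *)
have : \forall e \near 0^'+, forall (i : 'I_N.+1) (j : 'I_N') s s' t t',
    0 <= s <= e -> 0 <= s' <= e -> 0 <= t <= 1 -> 0 <= t' <= 1 ->
    between (p i + s *: n i) (p i + s *: n i) t <> edge (offset p' n' s') j t'.
  apply: filter_forall => i; apply: filter_forall => j.
  apply: stable_disjoint => t t' h h'; rewrite betweenaa => eq.
  by apply: (av i); [rewrite -ltnS|exists j, t'].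
apply: filterS => e h i s iN se [s' [j [t [jN s'e t01 eq]]]].
have iN' : (i < N.+1)%N by rewrite ltnS.
by apply: (h (Ordinal iN') (Ordinal jN) s s' t t) => //; rewrite betweenaa.
Qed.

Lemma stable_crossings p n N p' n' N' : simple_chain p N ->
    (forall i, (i <= N)%N -> ~ chain p' N' (p i)) ->
    (forall j, (j <= N')%N -> ~ chain p N (p' j)) ->
  \forall e \near 0^'+, strips_cross_at p n N p' n' N' e.
Proof.
move=> sp av av'.
have : \forall e \near 0^'+, forall (i : 'I_N) (j : 'I_N') s s',
    0 <= s <= e -> 0 <= s' <= e ->
    (edges_meet p p' i j ->
      cross_once (offset p n s i) (offset p n s i.+1)
                 (offset p' n' s' j) (offset p' n' s' j.+1)) /\
    (~ edges_meet p p' i j -> forall t t', 0 <= t <= 1 -> 0 <= t' <= 1 ->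
      edge (offset p n s) i t <> edge (offset p' n' s') j t').
  apply: filter_forall => i; apply: filter_forall => j.
  have iN := ltn_ord i; have jN := ltn_ord j.
  have [m|m] := pselect (edges_meet p p' i j); last first.
    have dis t t' : 0 <= t <= 1 -> 0 <= t' <= 1 -> edge p i t <> edge p' j t'.
      by move=> h h' eq; apply: m; exists t, t'.
    apply: filterS (stable_disjoint (n i) (n i.+1) (n' j) (n' j.+1) dis).
    by move=> e h s s' se s'e; split=> // _ t t'; exact: h.
  have [t [t' [t01 t'01 eq]]] := m.
  have [|D t_in t'_in] := crossing_transversal t01 t'01 eq (simple_chain_neq sp iN).
    move=> r r01; split=> [h|h|h|h].
    - by apply: (av' j (ltnW jN)); exists i, r.
    - by apply: (av' j.+1 jN); exists i, r.
    - by apply: (av i (ltnW iN)); exists j, r.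
    - by apply: (av i.+1 iN); exists j, r.
  have := stable_cross_once (n i) (n i.+1) (n' j) (n' j.+1) D t_in t'_in eq.
  by apply: filterS => e h s s' se s'e; split=> // _; exact: h.
by apply: filterS => e h s s' i j iN jN; exact: (h (Ordinal iN) (Ordinal jN)).
Qed.

Definition meeting_edges p N p' N' : {set 'I_N * 'I_N'} :=
  [set ij : 'I_N * 'I_N' | `[< edges_meet p p' ij.1 ij.2 >]]%SET.

(** [B] indexes copies of each arc at distinct displacements. A pair of meeting edges and a pair of
    copies determine one crossing, and strip injectivity recovers both pairs from the point. Taking
    [B] with one or two elements counts before and after the doubling. *)
Lemma card_crossings (B : finType) (o : B -> R) p n N p' n' N' e :
    injective o -> (forall b, 0 <= o b <= e) ->
    strip_injective_at p n N e -> strip_injective_at p' n' N' e ->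
    strips_cross_at p n N p' n' N' e ->
  ((\bigcup_b chain (offset p n (o b)) N) `&`
   (\bigcup_b chain (offset p' n' (o b)) N')
    #= `I_(#|meeting_edges p N p' N'| * (#|B| * #|B|)))%card.
Proof.
move=> oi oe inj inj' cr.
pose Z := (('I_N * 'I_N') * (B * B))%type.
(* Parameters are strictly interior so that the time [i + t] determines the edge [i]. *)
pose P (z : Z) (x : R * R) := exists t t', [/\ 0 < t < 1, 0 < t' < 1,
  x = edge (offset p n (o z.2.1)) z.1.1 t &
  x = edge (offset p' n' (o z.2.2)) z.1.2 t'].
pose A := finset.setX (meeting_edges p N p' N') [set: B * B]%SET.
have oo t : 0 < t < 1 -> 0 <= t <= 1 by case/andP => ? ?; rewrite !ltW.
have [f fP] : {f : Z -> R * R & forall z, z \in A -> P z (f z)}.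
  apply: (@choice _ _ (fun z x => z \in A -> P z x)) => -[[i j] [b b']].
  have [h|h] := boolP (((i, j), (b, b')) \in A); last by exists 0.
  move: h; rewrite !inE /= andbT => /asboolP m.
  have [/(_ m)[t [t' [h h' eq _]]] _] := cr _ _ _ _ (ltn_ord i) (ltn_ord j) (oe b) (oe b').
  by exists (edge (offset p n (o b)) i t) => _; exists t, t'.
have inj_ord (M : nat) (i j : 'I_M) t t' : 0 < t < 1 -> 0 < t' < 1 ->
    i%:R + t = j%:R + t' -> i = j.
  move=> /andP[t0 t1] /andP[t'0 t'1] eq; apply: val_inj => /=.
  have [/ltnW ij|/ltnW ij|//] := ltngtP (i : nat) j; apply/eqP; rewrite eqn_leq.
    rewrite ij /= -ltnS -(ltr_nat R) -natr1; lra.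
  rewrite ij andbT -ltnS -(ltr_nat R) -natr1; lra.
have Pinj z z' x : P z x -> P z' x -> z = z'.
  case: z z' => [[i j] [b b']] [[k l] [c c']] [t [t' [h h' /= -> e1]]].
  move=> [r [r' [g g' /= e2 e3]]].
  have [/oi -> ik] := inj _ _ _ _ _ _ (ltn_ord i) (ltn_ord k) (oe b) (oe c) (oo _ h) (oo _ g) e2.
  have [/oi -> jl] := inj' _ _ _ _ _ _ (ltn_ord j) (ltn_ord l) (oe b') (oe c')
    (oo _ h') (oo _ g') (etrans (esym e1) e3).
  by rewrite (inj_ord _ _ _ _ _ h g ik) (inj_ord _ _ _ _ _ h' g' jl).
rewrite (_ : _ `&` _ = f @` [set` A]).
  have -> : (#|meeting_edges p N p' N'| * (#|B| * #|B|))%N = #|A|.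
    by rewrite cardsX cardsT card_prod.
  by apply: card_eq_image_set => z z' zA z'A eq; apply: Pinj (fP _ zA) _; rewrite eq; exact: fP.
apply/seteqP; split=> [x|_ [z zA <-]]; last first.
  have [t [t' [h h' e1 e2]]] := fP _ zA; split.
    by exists z.2.1 => //; exists z.1.1, t; split=> //; exact: oo.
  by exists z.2.2 => //; exists z.1.2, t'; split=> //; exact: oo.
move=> [[b _ [i [t [iN t01 xE]]]] [b' _ [j [t' [jN t'01 xE']]]]].
have [c1 c2] := cr _ _ _ _ iN jN (oe b) (oe b').
have m : edges_meet p p' i j.
  by apply: contrapT => /c2/(_ _ _ t01 t'01); apply; rewrite -xE.
have zA : ((Ordinal iN, Ordinal jN), (b, b')) \in A.
  by rewrite !inE /= andbT; apply/asboolP.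
exists ((Ordinal iN, Ordinal jN), (b, b')) => //.
have [r [r' [h h' e1 e2]]] := fP _ zA.
have [q [q' [_ _ _ un]]] := c1 m.
rewrite /= in e1 e2.
have [rq _] := un _ _ (etrans (esym e1) e2).
have [tq _] := un _ _ (etrans (esym xE) xE').
by rewrite e1 xE rq tq.
Qed.

Lemma hairpin_strip p n N e : (0 < N)%N -> 0 < e ->
  chain (hairpin p n N e) N.*2.+1 `<=` strip p n N e.
Proof.
move=> N0 e0 x [i [t [iN t01 ->]]].
have [j [t' [s [jN t'01 se -> _]]]] := hairpin_edge p n N0 e0 t01 iN.
by exists s, j, t'.
Qed.

Lemma hairpin_vertex p n N e i : 0 < e -> (i <= N.*2.+1)%N ->
  exists2 j, (j <= N)%N & exists2 s, 0 <= s <= e & hairpin p n N e i = offset p n s j.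
Proof.
move=> e0 iN; rewrite /hairpin; case: leqP => iN'.
  by exists i => //; exists 0; rewrite ?offset0 // lexx ltW.
exists (N.*2.+1 - i)%N; first by lia.
by exists e; rewrite // lexx ltW.
Qed.

(** [F] stands for the other strip. A point of the closing edge is a moved last vertex and so misses
    [F]; within [F] the hairpin is just its two long sides. *)
Lemma hairpin_off_cap p n N e (F : set (R * R)) x : (0 < N)%N -> 0 < e ->
    (forall s, 0 <= s <= e -> ~ F (offset p n s N)) -> F x ->
  chain (hairpin p n N e) N.*2.+1 x <->
  (\bigcup_b chain (offset p n (if b then e else 0)) N) x.
Proof.
move=> N0 e0 cap Fx; split; last first.
  by move=> [b _ [i [t [iN t01 xE]]]]; rewrite xE; exact: edge_hairpin.
move=> [i [t [iN t01 xE]]].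
have [j [t' [s [jN t'01 se eq alt]]]] := hairpin_edge p n N0 e0 t01 iN.
rewrite eq in xE; case: alt => -[h1 h2].
- by exists false => //; exists j, t'; split; rewrite // xE h1.
- have jN' : (j%:R + 1 : R) <= N%:R by rewrite natr1 ler_nat.
  have t'1 : t' = 1 by case/andP: t'01; lra.
  have jE : j.+1 = N.
    by apply/eqP; rewrite -(eqr_nat R) -natr1; apply/eqP; lra.
  case: (cap s se); rewrite -jE.
  by move: xE; rewrite t'1 /edge between1 => <-.
- by exists true => //; exists j, t'; split; rewrite // xE h1.
Qed.

(** The 4 is [#|bool| * #|bool|], one Boolean for the side of each hairpin. *)
Lemma card_hairpin_crossings p n N p' n' N' e :
    (0 < N)%N -> (0 < N')%N -> 0 < e ->
    strip_injective_at p n N e -> strip_injective_at p' n' N' e ->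
    strips_cross_at p n N p' n' N' e ->
    vertices_avoid_at p n N p' n' N' e -> vertices_avoid_at p' n' N' p n N e ->
  (chain (hairpin p n N e) N.*2.+1 `&` chain (hairpin p' n' N' e) N'.*2.+1
    #= `I_(4 * #|meeting_edges p N p' N'|))%card.
Proof.
move=> N0 N'0 e0 inj inj' cr av av'.
have o_inj : injective (fun b : bool => if b then e else 0).
  by move=> [] [] // /eqP; rewrite ?(gt_eqF e0) // eq_sym (gt_eqF e0).
have oe (b : bool) : 0 <= (if b then e else 0) <= e by case: b; rewrite lexx ltW.
have := card_crossings o_inj oe inj inj' cr; rewrite card_bool mulnC.
congr (_ #= _)%card; apply/seteqP.
have h := hairpin_off_cap N0 e0 (fun s => av N s (leqnn N)).
have h' := hairpin_off_cap N'0 e0 (fun s => av' N' s (leqnn N')).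
have st b k (q m : nat -> R * R) :
    chain (offset q m (if b then e else 0)) k `<=` strip q m k e.
  by move=> x [j [t [jk t01 ->]]]; exists (if b then e else 0), j, t.
split=> x [].
  move=> [b _ xb] [b' _ xb']; split.
    by apply: (h _ (st _ _ _ _ _ xb')).2; exists b.
  by apply: (h' _ (st _ _ _ _ _ xb)).2; exists b'.
move=> xh xh'; split.
  exact: (h _ (hairpin_strip N'0 e0 xh')).1.
exact: (h' _ (hairpin_strip N0 e0 xh)).1.
Qed.

(** The case of a single copy at displacement 0, expressing the original count by the same number of
    meeting pairs. *)
Lemma card_chain_crossings p n N p' n' N' e : 0 < e ->
    strip_injective_at p n N e -> strip_injective_at p' n' N' e ->
    strips_cross_at p n N p' n' N' e ->
  (chain p N `&` chain p' N' #= `I_#|meeting_edges p N p' N'|)%card.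
Proof.
move=> e0 inj inj' cr.
have oe (b : unit) : 0 <= (0 : R) <= e by rewrite lexx ltW.
have := @card_crossings unit (fun=> 0) _ _ _ _ _ _ _ _ oe inj inj' cr.
rewrite card_unit !muln1 !offset0 !bigcup_const //; first by apply; case=> -[].
all: by exists tt.
Qed.

End Crossings.

(** * The doubled representation *)

Theorem proposition2 (R : realType) (k : nat) (hk : (1 <= k)%N)
    (V : finType) (e : rel V) (esym : symmetric e) (eirr : irreflexive e) :
  exact_string_graph R k e -> exact_string_graph R (4 * k)%N e.
Proof.
move=> [S [[cont adj] [sSp fin tri bad] exact]].
(* Properness is used with [u] as the third curve: its bends and endpoints lie on itself, hence on
   no other curve. *)
have avoid u v : u != v -> bends (S u) `|` endpoints (S u) `<=` ~` trace (S v).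
  move=> uv z bz vz; suff : (set0 : set (R * R)) z by [].
  rewrite -(bad u v u uv); split=> //; split=> //.
  case: bz => [[t [/andP[t0 t1] _] <-]|[->|->]].
  - by exists t; rewrite //= in_itv /= !ltW.
  - by exists 0; rewrite //= in_itv /= lexx ler01.
  - by exists 1; rewrite //= in_itv /= lexx ler01.
have /choice[N /choice[p pP]] : forall u, exists N p, [/\ (0 < N)%N,
    simple_chain p N, chain p N = trace (S u) &
    forall v i, u != v -> (i <= N)%N -> ~ trace (S v) (p i)].
  move=> u; have [ss pl] := sSp u.
  (* With [X] the union of all other curves, one chain for [u] works against every [v]. *)
  have [|N [p [N0 sp cp av]]] := curve_chain (X := [set x | exists2 v, u != v & trace (S v) x]) ss pl.
    by move=> z bz [v uv]; exact: avoid bz.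
  by exists N, p; split=> // v i uv iN h; apply: (av i iN); exists v.
have N0 u : (0 < N u)%N by case: (pP u).
have sp u : simple_chain (p u) (N u) by case: (pP u).
have cp u : chain (p u) (N u) = trace (S u) by case: (pP u).
have pav u v i : u != v -> (i <= N u)%N -> ~ chain (p v) (N v) (p u i).
  by rewrite cp; case: (pP u) => _ _ _; apply.
have /choice[n nP] : forall u, exists n, left_normals (p u) n (N u).
  by move=> u; exact: left_normals_exist.
have Finj : \forall d \near 0^'+, forall u, strip_injective_at (p u) (n u) (N u) d.
  by apply: filter_forall => u; exact: strip_injective.
have Fcr : \forall d \near 0^'+, forall u v, u != v ->
    strips_cross_at (p u) (n u) (N u) (p v) (n v) (N v) d.
  apply: filter_forall => u; apply: filter_forall => v.
  have [->|uv] := eqVneq u v; first exact: filterE.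
  have av' j : (j <= N v)%N -> ~ chain (p u) (N u) (p v j).
    by apply: pav; rewrite eq_sym.
  by apply: filterS (stable_crossings (n u) (n v) (sp u) (fun i => pav u v i uv) av').
have Fav : \forall d \near 0^'+, forall u v, u != v ->
    vertices_avoid_at (p u) (n u) (N u) (p v) (n v) (N v) d.
  apply: filter_forall => u; apply: filter_forall => v.
  have [->|uv] := eqVneq u v; first exact: filterE.
  by apply: filterS (stable_vertices (n u) (n v) (fun i => pav u v i uv)).
have Ftri : \forall d \near 0^'+, forall u v w, u != v -> u != w -> v != w ->
    strip (p u) (n u) (N u) d `&` strip (p v) (n v) (N v) d
      `&` strip (p w) (n w) (N w) d = set0.
  apply: filter_forall => u; apply: filter_forall => v; apply: filter_forall => w.
  have [[[uv uw] vw]|h] := pselect ((u != v /\ u != w) /\ v != w).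
    have := tri u v w uv uw vw; rewrite -!cp => /(stable_strips3 (n u) (n v) (n w)).
    by apply: filterS => d E _ _ _.
  by apply: filterE => d uv uw vw; case: h.
have Fpos : \forall d \near (0 : R)^'+, 0 < d by exact: nbhs_right_gt.
have [d [d0 inj cr av tr]] : exists d, [/\ 0 < d,
    forall u, strip_injective_at (p u) (n u) (N u) d,
    forall u v, u != v -> strips_cross_at (p u) (n u) (N u) (p v) (n v) (N v) d,
    forall u v, u != v -> vertices_avoid_at (p u) (n u) (N u) (p v) (n v) (N v) d &
    forall u v w, u != v -> u != w -> v != w ->
      strip (p u) (n u) (N u) d `&` strip (p v) (n v) (N v) d
      `&` strip (p w) (n w) (N w) d = set0].
  have [d h] := filter_ex (filterI Fpos (filterI Finj (filterI Fcr (filterI Fav Ftri)))).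
  by case: h => ? [? [? [? ?]]]; exists d; split.
pose q u := hairpin (p u) (n u) (N u) d.
pose M u := (N u).*2.+1.
have /choice[S' S'P] : forall u, exists g : R -> R * R, [/\ is_curve g,
    simple_curve g, piecewise_linear g, trace g = chain (q u) (M u) &
    bends g `|` endpoints g `<=` [set q u i | i in [set i | (i <= M u)%N]]].
  by move=> u; apply: simple_chain_curve => //; apply: hairpin_simple => //; exact: inj.
have tS' u : trace (S' u) = chain (q u) (M u) by case: (S'P u).
have tstrip u : trace (S' u) `<=` strip (p u) (n u) (N u) d.
  by rewrite tS'; exact: hairpin_strip.
have Scard u v : u != v -> (trace (S u) `&` trace (S v)
    #= `I_#|meeting_edges (p u) (N u) (p v) (N v)|)%card.
  by move=> uv; rewrite -!cp; apply: card_chain_crossings d0 _ _ (cr _ _ uv).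
have S'card u v : u != v -> (trace (S' u) `&` trace (S' v)
    #= `I_(4 * #|meeting_edges (p u) (N u) (p v) (N v)|))%card.
  move=> uv; rewrite !tS'; apply: card_hairpin_crossings => //; first exact: cr.
    exact: av.
  by apply: av; rewrite eq_sym.
exists S'; split.
- split=> [u|u v uv]; first by case: (S'P u).
  rewrite -adj // (card_eq_nonempty (Scard _ _ uv)) (card_eq_nonempty (S'card _ _ uv)).
  by rewrite muln_gt0.
- split.
  + by move=> u; case: (S'P u).
  + by move=> u v uv; apply/finite_setP; eexists; exact: S'card.
  + move=> u v w uv uw vw; apply/seteqP; split=> // x [[xu xv] xw].
    by rewrite -(tr u v w uv uw vw); split; [split|]; exact: tstrip.
  (* A bend or endpoint of curve [w] is a vertex of its hairpin and avoids every other strip; [w]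
     differs from [u] or from [v]. *)
  + move=> u v w uv; apply/seteqP; split=> // x [[xu xv] bx].
    have [_ _ _ _ /(_ _ bx)[i iM qx]] := S'P w.
    have [j jN [s sd qE]] := hairpin_vertex (p w) (n w) d0 iM.
    have off y : w != y -> ~ trace (S' y) x.
      move=> wy /tstrip yx; apply: (av w y wy j s jN sd).
      by rewrite -qE -/(q w) qx.
    have [wu|/off/(_ xu)//] := eqVneq w u.
    by apply: (off v) => //; rewrite wu.
(* The number of meeting pairs is 0 for disjoint curves and [k] otherwise, and the new count is four
   times this number. *)
- move=> u v uv; have S4 := S'card u v uv; have S1 := Scard u v uv.
  have [E|E] := exact u v uv; [left|right].
    have X0 : #|meeting_edges (p u) (N u) (p v) (N v)| = 0%N.
      apply/eqP; rewrite -leqn0 leqNgt; apply/negP => /(card_eq_nonempty S1).2.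
      by rewrite E => -[].
    by apply/eqP; rewrite -(@card_eq0 _ nat); move: S4; rewrite X0 muln0 II0.
  have : (`I_k #= `I_#|meeting_edges (p u) (N u) (p v) (N v)|)%card.
    by apply: card_eq_trans S1; rewrite card_eq_sym.
  by move=> /card_eq_II ->.
Qed.
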